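(* Let $(V,\partial_V,\mu_2,\mu_3,\dots)$ be an $A_\infty$ algebra, let $(W,\partial_W)$ be a chain complex, let $f:V\to W$ and $g:W\to V$ be chain maps, and let $h:V\to V$ be a linear map of degree $1$ with $gf-\mathrm{id}_V=\partial_Vh+h\partial_V$. Let $p_n$ ($n\ge2$) and $q_n$ ($n\ge 1$) be the $p$-kernels and $q$-kernels defined in the context. Then for all $n\ge2$ $$\partial_V q_n+\sum_{u=1}^n(-1)^nq_n\bigl(\mathrm{id}_V^{\otimes u-1}\otimes\partial_V\otimes \mathrm{id}_V^{\otimes n-u}\bigr)+\sum_{B(n)}(-1)^{\vartheta(r_1,\dots,r_k)}p_k\bigl(gf\circ q_{r_1}\otimes\cdots\otimes gf\circ q_{r_k}\bigr)$$ $$+\sum_{A(n)}(-1)^{i(\ell+1)+n}q_k\bigl(\mathrm{id}_V^{\otimes i-1}\otimes\mu_\ell\otimes \mathrm{id}_V^{\otimes k-i}\bigr)-q_1\mu_n=0 .$$ Consequently, the maps $$\nu_n:=f\circ p_n\circ g^{\otimes n},\qquad \varphi_n:=f\circ q_n,\qquad \psi_n:=h\circ p_n\circ g^{\otimes n},\qquad H_n:=h\circ q_n\qquad(n\ge2)$$ solve the problem of transfer of the $A_\infty$ structure: $(W,\partial_W,\nu_2,\nu_3,\dots)$ is an $A_\infty$ algebra, $\varphi=(f,\varphi_2,\varphi_3,\dots)$ is an $A_\infty$ morphism from $(V,\partial_V,\mu_2,\dots)$ to $(W,\partial_W,\nu_2,\dots)$, $\psi=(g,\psi_2,\psi_3,\dots)$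 is an $A_\infty$ morphism from $(W,\partial_W,\nu_2,\dots)$ to $(V,\partial_V,\mu_2,\dots)$, and $H=(h,H_2,H_3,\dots)$ is an $A_\infty$ homotopy between the composition $\psi\varphi$ and the identity morphism of $(V,\partial_V,\mu_2,\dots)$.
   Context: We work with $\mathbb Z$-graded modules over a commutative unital ring $R$ and graded $R$-linear maps. Chain complexes have differential of degree $-1$; chain maps have degree $0$. Koszul sign convention: $(a\otimes b)(c\otimes d)=(-1)^{|b||c|}ac\otimes bd$ for maps and $(a\otimes b)(x\otimes y)=(-1)^{|x||b|}a(x)\otimes b(y)$ for elements. Index sets: $A(n)$: triples $(k,\ell,i)$ of natural numbers with $k+\ell=n+1$, $k,\ell\ge2$, $1\le i\le k$. $B(n)$: tuples $(k,r_1,\dots,r_k)$ with $k\ge2$, all $r_j\ge1$, $r_1+\cdots+r_k=n$. $C(n)$: tuples $(k,i,r_1,\dots,r_i)$ with $2\le k\le n$, $1\le i\le k$, all $r_j\ge1$, $r_1+\cdots+r_i+k-i=n$. Sums over an empty set are $0$. $\vartheta(u_1,\dots,u_k)=\sum_{1\le i<j\le k}u_i(u_j+1)$. $A_\infty$ algebra $(V,\partial_V,\mu_2,\dots)$: a chain complex with maps $\mu_n:V^{\otimes n}\to V$ of degree $n-2$ such that for all $n\ge2$ $$\partial_V\mu_n-\sum_{i=1}^n(-1)^n\mu_n(\mathrm{id}^{\otimes i-1}\otimes\partial_V\otimes\mathrm{id}^{\otimes n-i})=\sum_{A(n)}(-1)^{i(\ell+1)+n}\mu_k(\mathrm{id}^{\otimes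 i-1}\otimes\mu_\ell\otimes\mathrm{id}^{\otimes k-i}).$$ $A_\infty$ morphism $\{f_n\}_{n\ge1}$ from $(V,\partial_V,\mu_2,\dots)$ to $(W,\partial_W,\nu_2,\dots)$: maps $f_n:V^{\otimes n}\to W$ of degree $n-1$ such that $f_1$ is a chain map and for all $n\ge2$ $$\partial_Wf_n+\sum_{B(n)}(-1)^{\vartheta(r_1,\dots,r_k)}\nu_k(f_{r_1}\otimes\cdots\otimes f_{r_k})=f_1\mu_n-\sum_{i=1}^n(-1)^nf_n(\mathrm{id}^{\otimes i-1}\otimes\partial_V\otimes\mathrm{id}^{\otimes n-i})-\sum_{A(n)}(-1)^{i(\ell+1)+n}f_k(\mathrm{id}^{\otimes i-1}\otimes\mu_\ell\otimes\mathrm{id}^{\otimes k-i}).$$ Composition: $(\psi\varphi)_n=\psi_1\varphi_n+\sum_{B(n)}(-1)^{\vartheta(r_1,\dots,r_k)}\psi_k(\varphi_{r_1}\otimes\cdots\otimes\varphi_{r_k})$. The identity morphism has components $\mathrm{id}_V$ for $n=1$ and $0$ for $n\ge 2$. $A_\infty$ homotopy between an $A_\infty$ endomorphism $\chi=(\chi_1,\chi_2,\dots)$ of $V$ and the identity: maps $H_n:V^{\otimes n}\to V$ of degree $n$ with $\chi_1-\mathrm{id}_V=\partial_VH_1+H_1\partial_V$ and, for all $n\ge2$, $$\chi_n=H_1\mu_n-\sum_{u=1}^n(-1)^nH_n(\mathrm{id}^{\otimes u-1}\otimes\partial_V\otimes\mathrm{id}^{\otimes n-u})-\sum_{A(n)}(-1)^{i(\ell+1)+n}H_k(\mathrm{id}^{\otimes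 i-1}\otimes\mu_\ell\otimes\mathrm{id}^{\otimes k-i})+\partial_VH_n$$ $$+\sum_{C(n)}(-1)^{n+r_i+\vartheta(r_1,\dots,r_i)}\mu_k(\chi_{r_1}\otimes\cdots\otimes\chi_{r_{i-1}}\otimes H_{r_i}\otimes\mathrm{id}^{\otimes k-i}).$$ $p$-kernels: $p_n:V^{\otimes n}\to V$, $n\ge2$, defined inductively by $p_n=\sum_{B(n)}(-1)^{\vartheta(r_1,\dots,r_k)}\mu_k(h\circ p_{r_1}\otimes\cdots\otimes h\circ p_{r_k})$ with the convention $h\circ p_1:=\mathrm{id}_V$. $q$-kernels: $q_n:V^{\otimes n}\to V$, defined inductively by $q_1=\mathrm{id}_V$ and, for $n\ge2$, $$q_n=\sum_{C(n)}(-1)^{n+r_i+\vartheta(r_1,\dots,r_i)}\mu_k\bigl((\psi\varphi)_{r_1}\otimes\cdots\otimes(\psi\varphi)_{r_{i-1}}\otimes h\circ q_{r_i}\otimes\mathrm{id}_V^{\otimes k-i}\bigr),$$ where $(\psi\varphi)_m=gf\circ q_m+\sum_{B(m)}(-1)^{\vartheta(r_1,\dots,r_k)}h\circ p_k(gf\circ q_{r_1}\otimes\cdots\otimes gf\circ q_{r_k})$. *)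

(* Defs.v *)
From HB Require Import structures.
From mathcomp Require Import all_boot all_order all_algebra.
From mathcomp Require Import all_classical.

Set Implicit Arguments.
Unset Strict Implicit.
Unset Printing Implicit Defensive.

Import Order.TTheory GRing.Theory Num.Theory.

Local Open Scope classical_set_scope.
Local Open Scope ring_scope.

(* A direct sum decomposition of an R-module into submodules V_i, i : int,
   given by the projections V -> V_i. *)
Record gradedModule (R : comPzRingType) := GradedModule {
  gm_sort :> lmodType R;
  gm_proj : int -> {linear gm_sort -> gm_sort};
  gm_projK : forall i j x,
    gm_proj i (gm_proj j x) = if i == j then gm_proj j x else 0;
  gm_fin : forall x, finite_set [set i | gm_proj i x != 0];
  gm_sum : forall x, \sum_(i \in [set: int]) gm_proj i x = x
}.

Definition homog (R : comPzRingType) (V : gradedModule R) (i : int) (x : V) :=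
  gm_proj V i x = x.

Record chainComplex (R : comPzRingType) := ChainComplex {
  cc_gm :> gradedModule R;
  cc_diff : {linear cc_gm -> cc_gm};
  cc_diff_deg : forall i (x : cc_gm), homog i x -> homog (i - 1) (cc_diff x);
  cc_diff2 : forall x, cc_diff (cc_diff x) = 0
}.

Notation "\d x" := (cc_diff _ x) (at level 10, x at level 8).

(* A map F : V^{\otimes n} -> W is encoded by the multilinear function
   (x_1, ..., x_n) |-> F (x_1 \otimes ... \otimes x_n), applied to sequences.
   Only its values on sequences of length n are meaningful, and every
   condition below is restricted to those. *)

Section GradedMaps.
Variables (R : comPzRingType) (V W : gradedModule R).

Definition multilinear (n : nat) (F : seq V -> W) :=
  forall (s1 s2 : seq V) (a : R) (x y : V), (size s1 + size s2).+1 = n ->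
    F (s1 ++ (a *: x + y) :: s2) = a *: F (s1 ++ x :: s2) + F (s1 ++ y :: s2).

Definition has_degree (n : nat) (d : int) (F : seq V -> W) :=
  forall (e : seq int) (s : seq V), size e = n -> size s = n ->
    (forall j, (j < n)%N -> homog (nth 0 e j) (nth 0 s j)) ->
    homog ((\sum_(i <- e) i) + d) (F s).

Definition graded_map (n : nat) (d : int) (F : seq V -> W) :=
  multilinear n F /\ has_degree n d F.

Definition unary (a : V -> W) : seq V -> W := fun s => a (head 0 s).

(* The family (a, F_2, F_3, ...). *)
Definition with_first (a : V -> W) (F : nat -> seq V -> W) : nat -> seq V -> W :=
  fun n => if n == 1%N then unary a else F n.

End GradedMaps.

(* The linear map x |-> (-1)^{|x| b} x: the Koszul sign for moving x past a map
   of degree b. *)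
Definition koszul (R : comPzRingType) (V : gradedModule R) (b : int) (x : V) : V :=
  \sum_(i \in [set: int]) (-1) ^+ absz (i * b) *: gm_proj V i x.

Lemma koszul_homog (R : comPzRingType) (V : gradedModule R) (b i : int) (x : V) :
  homog i x -> koszul b x = (-1) ^+ absz (i * b) *: x.
Proof.
move=> hx; rewrite /koszul -(@fsbig_widen _ _ _ _ [set i]) ?fsbig_set1 ?hx //.
move=> j /= [_ /eqP ji].
by rewrite -hx gm_projK (negbTE ji) scaler0.
Qed.

(* A tensor factor: a map of degree [tf_deg] on [tf_arity] arguments. *)
Record tfactor (R : comPzRingType) (U V : gradedModule R) := TFactor {
  tf_arity : nat;
  tf_deg : int;
  tf_fun : seq U -> V
}.

(* The map f_1 \otimes ... \otimes f_k, sending a decomposable tensor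
   x_1 \otimes ... \otimes x_n, n = r_1 + ... + r_k, to
   \pm f_1(x_1, ..., x_{r_1}) \otimes f_2(x_{r_1 + 1}, ...) \otimes ...
   Each argument of f_j moves past f_{j+1}, ..., f_k, which gives the sign; it
   is put on the arguments, so that no homogeneity needs to be assumed. *)
Fixpoint tensor (R : comPzRingType) (U V : gradedModule R)
    (fs : seq (tfactor U V)) (s : seq U) : seq V :=
  if fs is f :: fs' then
    tf_fun f [seq koszul (\sum_(f' <- fs') tf_deg f') x | x <- take (tf_arity f) s]
      :: tensor fs' (drop (tf_arity f) s)
  else [::].

Definition idf (R : comPzRingType) (V : gradedModule R) : tfactor V V :=
  TFactor 1 0 (unary id).

(* id^{\otimes i-1} \otimes m \otimes id^{\otimes k-i} *)
Definition insert (R : comPzRingType) (V : gradedModule R)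
    (k i : nat) (m : tfactor V V) : seq V -> seq V :=
  tensor (nseq i.-1 (idf V) ++ m :: nseq (k - i) (idf V)).

Definition difff (R : comPzRingType) (V : chainComplex R) : tfactor V V :=
  TFactor 1 (- 1) (unary (cc_diff V)).

Section Sums.
Variable M : nmodType.

Definition sumA (n : nat) (F : nat -> nat -> nat -> M) : M :=
  \sum_(2 <= k < n.+1) \sum_(2 <= l < n.+1 | (k + l == n.+1)%N)
    \sum_(1 <= i < k.+1) F k l i.

Definition sumB (n : nat) (F : seq nat -> M) : M :=
  \sum_(2 <= k < n.+1)
    \sum_(r : k.-tuple 'I_n.+1 |
          all (fun j => 0 < j)%N (map val r) && (sumn (map val r) == n))
      F (map val r).

Definition sumC (n : nat) (F : nat -> nat -> seq nat -> M) : M :=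
  \sum_(2 <= k < n.+1) \sum_(1 <= i < k.+1)
    \sum_(r : i.-tuple 'I_n.+1 |
          all (fun j => 0 < j)%N (map val r)
          && (sumn (map val r) + (k - i) == n)%N)
      F k i (map val r).

End Sums.

Definition vartheta (u : seq nat) : nat :=
  (\sum_(j < size u) \sum_(i < j) nth 0 u i * (nth 0 u j).+1)%N.

(* \sum_{B(n)} (-1)^{vartheta(r)} m_k (f_{r_1} \otimes ... \otimes f_{r_k}), for
   maps f_r of degree r - 1. *)
Definition Bsum (R : comPzRingType) (U V W : gradedModule R)
    (m : nat -> seq V -> W) (f : nat -> seq U -> V) (n : nat) (s : seq U) : W :=
  sumB n (fun r => (-1) ^+ vartheta r *:
    m (size r) (tensor [seq TFactor j (j%:Z - 1) (f j) | j <- r] s)).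

Definition Asum (R : comPzRingType) (V W : gradedModule R)
    (f : nat -> seq V -> W) (mu : nat -> seq V -> V) (n : nat) (s : seq V) : W :=
  sumA n (fun k l i => (-1) ^+ (i * l.+1 + n) *:
    f k (insert k i (TFactor l (l%:Z - 2) (mu l)) s)).

(* \sum_{C(n)} (-1)^{n+r_i+vartheta(r)}
     mu_k (chi_{r_1} \otimes ... \otimes chi_{r_{i-1}} \otimes H_{r_i}
           \otimes id^{k-i}),
   for maps chi_r of degree r - 1 and H_r of degree r. *)
Definition Csum (R : comPzRingType) (V : gradedModule R)
    (mu chi H : nat -> seq V -> V) (n : nat) (s : seq V) : V :=
  sumC n (fun k i r => (-1) ^+ (n + last 0%N r + vartheta r) *:
    mu k (tensor ([seq TFactor j (j%:Z - 1) (chi j) | j <- take i.-1 r]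
                  ++ TFactor (last 0%N r) (last 0%N r)%:Z (H (last 0%N r))
                  :: nseq (k - i) (idf V)) s)).

Definition dsum (R : comPzRingType) (V : chainComplex R) (W : gradedModule R)
    (f : nat -> seq V -> W) (n : nat) (s : seq V) : W :=
  \sum_(1 <= i < n.+1) (-1) ^+ n *: f n (insert n i (difff V) s).

Definition Ainf_algebra (R : comPzRingType) (V : chainComplex R)
    (mu : nat -> seq V -> V) :=
  forall n, (2 <= n)%N ->
    graded_map n (n%:Z - 2) (mu n) /\
    forall s, size s = n -> \d (mu n s) - dsum mu n s = Asum mu mu n s.

Definition chain_map (R : comPzRingType) (V W : chainComplex R) (f : V -> W) :=
  graded_map 1 0 (unary f) /\ forall x, \d (f x) = f (\d x).

Definition Ainf_morphism (R : comPzRingType) (V W : chainComplex R)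
    (mu : nat -> seq V -> V) (nu : nat -> seq W -> W)
    (f : nat -> seq V -> W) :=
  chain_map (fun x => f 1%N [:: x]) /\
  forall n, (2 <= n)%N ->
    graded_map n (n%:Z - 1) (f n) /\
    forall s, size s = n ->
      \d (f n s) + Bsum nu f n s
      = f 1%N [:: mu n s] - dsum f n s - Asum f mu n s.

Definition Ainf_comp (R : comPzRingType) (U V W : gradedModule R)
    (psi : nat -> seq V -> W) (phi : nat -> seq U -> V) : nat -> seq U -> W :=
  fun n s => psi 1%N [:: phi n s] + Bsum psi phi n s.

Definition Ainf_homotopy_id (R : comPzRingType) (V : chainComplex R)
    (mu chi H : nat -> seq V -> V) :=
  [/\ Ainf_morphism mu mu chi,
      graded_map 1 1 (H 1%N),
      forall x, chi 1%N [:: x] - x = \d (H 1%N [:: x]) + H 1%N [:: \d x] &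
      forall n, (2 <= n)%N ->
        graded_map n n%:Z (H n) /\
        forall s, size s = n ->
          chi n s = H 1%N [:: mu n s] - dsum H n s - Asum H mu n s
                    + \d (H n s) + Csum mu chi H n s].

Section Kernels.
Variables (R : comPzRingType) (V : gradedModule R).
Variables (mu : nat -> seq V -> V) (gf h : V -> V).

(* h \circ p_r, with the convention h \circ p_1 = id *)
Definition hp (p : nat -> seq V -> V) : nat -> seq V -> V :=
  with_first id (fun r s => h (p r s)).

Definition p_step (p : nat -> seq V -> V) : nat -> seq V -> V :=
  Bsum mu (hp p).

(* Since p_step at n only involves indices smaller than n, n iterations
   determine p_n; see p_kernelE. *)
Definition p_kernel (n : nat) : seq V -> V :=
  iter n p_step (fun _ _ => 0) n.

(* (psi phi)_m in terms of the q_r, r <= m *)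
Definition psiphi (q : nat -> seq V -> V) (m : nat) (s : seq V) : V :=
  gf (q m s)
  + Bsum (fun k t => h (p_kernel k t)) (fun r t => gf (q r t)) m s.

Definition q_step (q : nat -> seq V -> V) : nat -> seq V -> V :=
  with_first id (Csum mu (psiphi q) (fun r s => h (q r s))).

Definition q_kernel (n : nat) : seq V -> V :=
  iter n q_step (fun _ _ => 0) n.

End Kernels.

Lemma eq_sumB (M : nmodType) n (F G : seq nat -> M) :
  (forall r, all (fun j => 0 < j < n)%N r -> F r = G r) -> sumB n F = sumB n G.
Proof.
move=> eqFG; apply: eq_big_nat => k /andP[k2 _]; apply: eq_bigr => r.
move=> /andP[r0 /eqP rn]; apply: eqFG.
have sr : (2 <= size (map val r))%N by rewrite size_map size_tuple.
apply/(all_nthP 0%N) => j jr; have := allP r0 _ (mem_nth 0%N jr) => /= -> /=.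
move: r0 rn sr jr; move: (map val r) => {}r r0 <- sr jr.
have P i : (i < size r)%N -> (0 < nth 0 r i)%N by move/(all_nthP 0%N): r0; apply.
rewrite sumnE (big_nth 0%N) big_mkord (bigD1 (Ordinal jr)) //= -ltn_subLR ?subnn //.
have [i ir ij] : exists2 i, (i < size r)%N & i != j.
  by case: (j =P 0%N) => [->|/eqP h]; [exists 1%N|exists 0%N; rewrite // 1?eq_sym // (ltn_trans _ sr)].
by rewrite (bigD1 (Ordinal ir)) //= addn_gt0 P.
Qed.

Lemma eq_sumC (M : nmodType) n (F G : nat -> nat -> seq nat -> M) :
  (forall k i r, all (fun j => 0 < j < n)%N r -> r != [::] ->
     F k i r = G k i r) -> sumC n F = sumC n G.
Proof.
move=> eqFG; apply: eq_big_nat => k /andP[k2 _].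
apply: eq_big_nat => i /andP[i1 ik]; apply: eq_bigr => r /andP[r0 /eqP rn].
have sr : size (map val r) = i by rewrite size_map size_tuple.
apply: eqFG; last by rewrite -size_eq0 sr -lt0n.
move: r0 rn sr; move: (map val r) => {}r r0 rn sr.
apply/(all_nthP 0%N) => j jr; have := allP r0 _ (mem_nth 0%N jr) => /= -> /=.
have P l : (l < size r)%N -> (0 < nth 0 r l)%N by move/(all_nthP 0%N): r0; apply.
rewrite -rn sumnE (big_nth 0%N) big_mkord (bigD1 (Ordinal jr)) //= -addnA.
rewrite -ltn_subLR ?subnn //.
have [ik'|ki] := ltnP i k; first by rewrite addn_gt0 subn_gt0 ik' orbT.
have sr2 : (1 < size r)%N by rewrite sr (leq_trans k2).
have [l lr lj] : exists2 l, (l < size r)%N & l != j.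
  by case: (j =P 0%N) => [->|/eqP h]; [exists 1%N|exists 0%N; rewrite // 1?eq_sym // (ltn_trans _ sr2)].
by rewrite (bigD1 (Ordinal lr)) //= !addn_gt0 P.
Qed.

Lemma eq_Bsum (R : comPzRingType) (U V W : gradedModule R)
    (m : nat -> seq V -> W) (f f' : nat -> seq U -> V) n s :
  (forall r, (0 < r < n)%N -> f r = f' r) -> Bsum m f n s = Bsum m f' n s.
Proof.
move=> e; apply: eq_sumB => r /allP rn; congr (_ *: m _ (tensor _ _)).
by apply/eq_in_map => j /rn /e ->.
Qed.

Section KernelsE.
Variables (R : comPzRingType) (V : gradedModule R).
Variables (mu : nat -> seq V -> V) (gf h : V -> V).

Let p_local a b n : (n <= a)%N -> (n <= b)%N ->
  iter a (p_step mu h) (fun _ _ => 0) n = iter b (p_step mu h) (fun _ _ => 0) n.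
Proof.
elim/ltn_ind: n a b => -[|n] IHn [|a] [|b] // la lb.
- by apply/funext => s; rewrite /= /p_step /Bsum /sumB big_geq.
- by apply/funext => s; rewrite /= /p_step /Bsum /sumB big_geq.
- by apply/funext => s; rewrite /= /p_step /Bsum /sumB !big_geq.
apply/funext => s; apply: eq_Bsum => r /andP[r0 rn].
rewrite /hp /with_first; case: eqP => // _; apply/funext => t.
by congr h; apply: (congr1 (@^~ t)); apply: IHn => //;
  rewrite -ltnS (leq_trans rn).
Qed.

Lemma p_kernelE n s : p_kernel mu h n s = Bsum mu (hp h (p_kernel mu h)) n s.
Proof.
rewrite /p_kernel (@p_local n n.+1) //=; apply: eq_Bsum => r /andP[_ rn].
rewrite /hp /with_first; case: eqP => // _; apply/funext => t.
by rewrite (@p_local n r) // ltnW.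
Qed.

Let q_step_local q q' n : (forall r, (0 < r < n)%N -> q r = q' r) ->
  q_step mu gf h q n = q_step mu gf h q' n.
Proof.
move=> e; apply/funext => s; rewrite /q_step /with_first; case: eqP => // _.
apply: eq_sumC => k i r rn r0; have lr : last 0%N r \in r.
  by case: r r0 {rn} => // a r _; rewrite /= mem_last.
move/allP: rn => rn; have -> : q (last 0%N r) = q' (last 0%N r) by exact/e/rn.
congr (_ *: mu _ (tensor (_ ++ _) _)).
apply/eq_in_map => j /mem_take /rn /andP[j0 jn]; congr TFactor.
apply/funext => t; rewrite /psiphi e ?j0 //; congr (_ + _).
apply: eq_Bsum => l /andP[l0 lj]; apply/funext => u.
by rewrite e // l0 (ltn_trans lj).
Qed.

Let q_local a b n : (0 < n <= a)%N -> (n <= b)%N ->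
  iter a (q_step mu gf h) (fun _ _ => 0) n = iter b (q_step mu gf h) (fun _ _ => 0) n.
Proof.
elim/ltn_ind: n a b => -[|n] IHn [|a] [|b] // la lb; apply: q_step_local.
move=> r /andP[r0 rn]; have [ra rb] : (r <= a)%N /\ (r <= b)%N by split; rewrite -ltnS (leq_trans rn).
by apply: IHn; rewrite // r0.
Qed.

Lemma q_kernel1 x : q_kernel mu gf h 1 [:: x] = x.
Proof. by []. Qed.

Lemma q_kernelE n s : (2 <= n)%N ->
  q_kernel mu gf h n s =
  Csum mu (psiphi mu gf h (q_kernel mu gf h))
       (fun r t => h (q_kernel mu gf h r t)) n s.
Proof.
case: n => [|n] // n1; rewrite /q_kernel /=.
rewrite (@q_step_local _ (q_kernel mu gf h)).
  by rewrite /q_step /with_first eqn_leq leqNgt n1.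
by move=> r /andP[r0 rn]; apply: q_local; rewrite // r0.
Qed.

End KernelsE.

(* Main.v *)
(** Conjugating every structure map by the suspension, with the sign
    (-1)^(n(n-1)/2) on arity n, absorbs the signs of the definitions: Bsum
    becomes a sum of m(f(s_1), ..., f(s_k)) over all splittings of a word into
    blocks, dsum + Asum - f_1 mu becomes -F D with D the coderivation of the
    suspended structure b = d + b', and the degree of a map only enters through its parity
    with respect to an involution tau.  A linear combination of words is
    represented by its action on multiadditive functions G of words, so that
    all identities between morphisms and coderivations of tensor coalgebras
    follow from one composition law for weighted splittings, wsplit_comp.

    In these terms p = b' P with P = 1 + h p, psi = P g, nu = f p g, and for
    K = h q, q = 1 + b' [chi, K, 1], where [chi, K, 1] is the sum of all
    chi ... chi K 1 ... 1.  Both defects below vanish by induction on arity,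
    as b' has no linear part:
    - E = b psi - psi D_W satisfies E = h b' (psi, E, psi);
    - E = d q + b' chi - q D satisfies
        E = b' ((chi - 1) - D [chi, K, 1] - [chi, K, 1] D),
      where D [chi, K, 1] + [chi, K, 1] D differs from chi - 1 only by terms
      containing h E or the defect b chi - chi D; the latter vanishes where
      E does, because chi = psi phi with phi = f q. *)

Require Import Defs.
From HB Require Import structures.
From mathcomp Require Import all_boot all_order all_algebra.
From mathcomp Require Import all_classical.
From mathcomp Require Import zify.

Set Implicit Arguments.
Unset Strict Implicit.
Unset Printing Implicit Defensive.

Import Order.TTheory GRing.Theory Num.Theory.

Local Open Scope ring_scope.

(** * Splittings of words into blocks *)

Section Cuts.
Variable T : eqType.
Implicit Types s : seq T.

(** Weights indexed by a finite set make splittings compose like matrices. A morphism is a 1 by 1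
    matrix, a coderivation is the corner entry of an upper triangular 2 by 2 matrix, and composition
    pairs the index sets. A composite of two coderivations is then a sum over paths across a square:
    the diagonal jump is the case of both marks in one outer block, the two other routes are the two
    orders of marks in different blocks.

    The last point is what makes the anticommutator of [D] and [[chi, K, 1]] computable. Every
    prefix of an odd component carries [tau]; where two odd components are crossed, [tau] squares to
    1, and the terms with [K] and [b] in separate blocks cancel in pairs.

    The induction may use a defect on strictly shorter words only, and there are two sources of
    shorter words. The defect of [chi] always stands beside a nonempty block fed to [K], so its own
    block is proper. The term with [h E] has no such companion; if its block is the whole word, then
    [b'] receives one letter and vanishes. *)

Fixpoint cuts s : seq (seq T * seq T) :=
  if s is x :: s' then ([::], s) :: [seq (x :: p.1, p.2) | p <- cuts s']
  else [:: ([::], [::])].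

Lemma big_cuts_cons (M : nmodType) x s (H : seq T * seq T -> M) :
  \sum_(p <- cuts (x :: s)) H p
  = H ([::], x :: s) + \sum_(p <- cuts s) H (x :: p.1, p.2).
Proof. by rewrite big_cons big_map. Qed.

Lemma big_cuts0 (M : nmodType) (H : seq T * seq T -> M) :
  \sum_(p <- cuts [::]) H p = H ([::], [::]).
Proof. exact: big_seq1. Qed.

(** Coassociativity of deconcatenation: both sides run over the cuts into three words. *)
Lemma cuts_coassoc (M : nmodType) s (H : seq T -> seq T -> seq T -> M) :
  \sum_(p <- cuts s) \sum_(q <- cuts p.1) H q.1 q.2 p.2
  = \sum_(p <- cuts s) \sum_(q <- cuts p.2) H p.1 q.1 q.2.
Proof.
elim: s H => [|x s IHs] H; first by rewrite !big_cuts0.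
rewrite !big_cuts_cons /= big_seq1.
under eq_bigr do rewrite big_cuts_cons /=.
by rewrite big_split /= addrA (IHs (fun a => H (x :: a))).
Qed.

Lemma cat_cuts s p : p \in cuts s -> p.1 ++ p.2 = s.
Proof.
elim: s p => [|x s IHs] p; first by rewrite inE => /eqP->.
rewrite inE => /orP[/eqP->//|/mapP[q /IHs <- ->]] //.
Qed.

Lemma size_cuts s p : p \in cuts s -> (size p.1 + size p.2)%N = size s.
Proof. by move=> /cat_cuts <-; rewrite size_cat. Qed.

Lemma cutsE s : cuts s = [seq (take m s, drop m s) | m <- iota 0 (size s).+1].
Proof.
elim: s => [|x s IHs] //; have -> : iota 0 (size (x :: s)).+1
  = 0%N :: [seq m.+1 | m <- iota 0 (size s).+1] by rewrite -(iotaDl 1 0).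
by rewrite /= -map_comp /= IHs -!map_comp.
Qed.

End Cuts.

Lemma cuts_map (T T' : eqType) (phi : T -> T') s :
  cuts (map phi s) = [seq (map phi p.1, map phi p.2) | p <- cuts s].
Proof. by elim: s => [|x s IHs] //=; rewrite IHs -!map_comp. Qed.

(** * Splittings weighted along paths in a finite index set *)

Section WeightedSplit.
Variables (V : eqType) (W M : zmodType) (I : finType).
Implicit Types (F : I -> I -> seq V -> W) (G : seq W -> M) (s : seq V).

(* Sums [G (F i_0 i_1 s_1, F i_1 i_2 s_2, ..., F i_{k-1} i_k s_k)] over all
   splittings of [s] into nonempty blocks [s_1, ..., s_k] and all paths
   [i = i_0, i_1, ..., i_k = j]. *)
Fixpoint wsplit_rec n F (i j : I) G s : M :=
  match s, n with
  | [::], _ => if i == j then G [::] else 0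
  | x :: s', 0 => 0
  | x :: s', n'.+1 => \sum_(p <- cuts s') \sum_k
      wsplit_rec n' F k j (fun w => G (F i k (x :: p.1) :: w)) p.2
  end.

Definition wsplit F i j G s := wsplit_rec (size s) F i j G s.

Lemma wsplit0 F i j G : wsplit F i j G [::] = if i == j then G [::] else 0.
Proof. by []. Qed.

Lemma wsplit_cons F i j G x s :
  wsplit F i j G (x :: s) = \sum_(p <- cuts s) \sum_k
    wsplit F k j (fun w => G (F i k (x :: p.1) :: w)) p.2.
Proof.
(* Each block uses up at least one letter, so any fuel of at least [size s] gives the same sum and
   the default 0 for exhausted fuel is never reached. *)
have fuel n : forall i G s, (size s <= n)%N ->
    wsplit_rec n F i j G s = wsplit F i j G s.
  elim/ltn_ind: n => n IHn {}i {}G [|y t]; first by case: n IHn.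
  case: n IHn => // n IHn tn; rewrite /wsplit /=.
  rewrite [LHS]big_seq [RHS]big_seq; apply: eq_bigr => p /size_cuts pt.
  have p2 : (size p.2 <= size t)%N by rewrite -pt leq_addl.
  by apply: eq_bigr => k _; rewrite !IHn ?(leq_trans p2).
rewrite {1}/wsplit /= [LHS]big_seq [RHS]big_seq; apply: eq_bigr => p /size_cuts ps.
by apply: eq_bigr => k _; rewrite fuel // -ps leq_addl.
Qed.

(** Blocks are nonempty, so [G] only sees words that are no longer than [s] and that are empty
    exactly when [s] is. With these side conditions, equations known only on nonempty words of
    bounded length can be substituted. *)
Lemma eq_wsplit F F' i j G G' s :
  (forall i k a, a != [::] -> (size a <= size s)%N -> F i k a = F' i k a) ->
  (forall w, (size w <= size s)%N -> (w == [::]) = (s == [::]) -> G w = G' w) ->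
  wsplit F i j G s = wsplit F' i j G' s.
Proof.
have [n] := ubnP (size s); elim: n s i G G' => // n IHn [|x s] i G G' /=.
  by move=> _ _ eG; rewrite !wsplit0 eG.
rewrite ltnS => sn eF eG; rewrite !wsplit_cons [LHS]big_seq [RHS]big_seq.
apply: eq_bigr => p /size_cuts ps; apply: eq_bigr => k _.
have p1 : (size p.1 <= size s)%N by rewrite -ps leq_addr.
have p2 : (size p.2 <= size s)%N by rewrite -ps leq_addl.
apply: IHn => [|i' k' a a0 ap|w wp _]; first exact: leq_ltn_trans p2 _.
  by rewrite eF // (leq_trans ap) // ltnW.
by rewrite eF //= eG //= ltnS (leq_trans wp).
Qed.

Lemma eq_wsplitr F i j G G' s :
  G =1 G' -> wsplit F i j G s = wsplit F i j G' s.
Proof. by move=> eG; apply: eq_wsplit. Qed.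

Lemma wsplitD F i j G G' s :
  wsplit F i j (fun w => G w + G' w) s = wsplit F i j G s + wsplit F i j G' s.
Proof.
have [n] := ubnP (size s); elim: n s i G G' => // n IHn [|x s] i G G' /=.
  by rewrite !wsplit0; case: ifP; rewrite ?addr0.
rewrite ltnS => sn; rewrite !wsplit_cons -big_split /= [LHS]big_seq [RHS]big_seq.
apply: eq_bigr => p /size_cuts ps; rewrite -big_split; apply: eq_bigr => k _.
by rewrite IHn // (leq_ltn_trans _ (sn : size s < n)%N) // -ps leq_addl.
Qed.

Lemma wsplit_zero F i j s : wsplit F i j (fun=> 0) s = 0.
Proof. by apply: (addrI (wsplit F i j (fun=> 0) s)); rewrite -wsplitD !addr0. Qed.

Lemma wsplit_sum (J : Type) (r : seq J) F i j (G : J -> seq W -> M) s :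
  wsplit F i j (fun w => \sum_(l <- r) G l w) s
  = \sum_(l <- r) wsplit F i j (G l) s.
Proof.
elim: r => [|l r IHr].
  rewrite big_nil -[RHS](wsplit_zero F i j s); apply: eq_wsplit => // w _ _.
  by rewrite big_nil.
rewrite big_cons -IHr -wsplitD; apply: eq_wsplit => // w _ _.
by rewrite big_cons.
Qed.

(** Compatibility with deconcatenation: a cut of the word of blocks is a cut of [s] between two
    blocks, and the path is cut there at some index [k]. *)
Lemma wsplit_cuts F i j (H : seq W -> seq W -> M) s :
  wsplit F i j (fun w => \sum_(p <- cuts w) H p.1 p.2) s
  = \sum_(p <- cuts s) \sum_k
      wsplit F i k (fun a => wsplit F k j (H a) p.2) p.1.
Proof.
have [n] := ubnP (size s); elim: n s i H => // n IHn [|x s] i H /= sn.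
  rewrite big_cuts0 !wsplit0 big_cuts0 (bigD1 i) //= big1 => [|k /negPf ki].
    by rewrite addr0 !wsplit0 eqxx.
  by rewrite !wsplit0 eq_sym ki.
rewrite big_cuts_cons wsplit_cons.
have split_first k v t :
    wsplit F k j (fun w => \sum_(p <- cuts (v :: w)) H p.1 p.2) t
    = wsplit F k j (fun w => H [::] (v :: w)) t
      + wsplit F k j (fun w => \sum_(p <- cuts w) H (v :: p.1) p.2) t.
  by rewrite -wsplitD; apply: eq_wsplitr => w; rewrite big_cuts_cons.
under [LHS]eq_bigr do under eq_bigr do rewrite split_first.
under [LHS]eq_bigr do rewrite big_split; rewrite big_split /=; congr (_ + _).
  rewrite /= [RHS](bigD1 i) //= [X in _ = _ + X]big1 => [|k /negPf ki]; last first.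
    by rewrite wsplit0 eq_sym ki.
  by rewrite wsplit0 eqxx wsplit_cons addr0.
under [RHS]eq_bigr do under eq_bigr do rewrite wsplit_cons.
under [RHS]eq_bigr do rewrite exchange_big /=.
rewrite (cuts_coassoc _ (fun a b c => \sum_l \sum_k wsplit F k l
  (fun w => wsplit F l j (H (F i k (x :: a) :: w)) c) b)).
rewrite [LHS]big_seq [RHS]big_seq; apply: eq_bigr => p /size_cuts ps.
under [RHS]eq_bigr do rewrite exchange_big.
rewrite [RHS]exchange_big; apply: eq_bigr => k _ /=.
rewrite (IHn _ k (fun a => H (F i k (x :: p.1) :: a))) //.
by rewrite (leq_ltn_trans _ (sn : size s < n)%N) // -ps leq_addl.
Qed.

End WeightedSplit.

Arguments wsplit_zero {V W M I}.

(** * The composition law *)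

Section Composition.

Definition multiadd (W M : zmodType) (G : seq W -> M) :=
  forall s t x y, G (s ++ (x + y) :: t) = G (s ++ x :: t) + G (s ++ y :: t).

Lemma multiadd_cons (W M : zmodType) (G : seq W -> M) v :
  multiadd G -> multiadd (fun w => G (v :: w)).
Proof. by move=> Gadd s; apply: Gadd (v :: s). Qed.

Lemma multiadd0 (W M : zmodType) (G : seq W -> M) s t :
  multiadd G -> G (s ++ 0 :: t) = 0.
Proof.
by move=> Gadd; apply: (addrI (G (s ++ 0 :: t))); rewrite -Gadd !addr0.
Qed.

Lemma wsplit_multiadd_head (V : eqType) (W M : zmodType) (I : finType)
    (F : I -> I -> seq V -> W) (G : seq W -> M) i j s x y :
  multiadd G ->
  wsplit F i j (fun w => G (x + y :: w)) s
  = wsplit F i j (fun w => G (x :: w)) s + wsplit F i j (fun w => G (y :: w)) s.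
Proof.
by move=> Gadd; rewrite -wsplitD; apply: eq_wsplitr => w; apply: (Gadd [::]).
Qed.

Lemma wsplit_additive (V : eqType) (W M M' : zmodType) (I : finType)
    (F : I -> I -> seq V -> W) (G : seq W -> M) (phi : M -> M') i j s :
  {morph phi : x y / x + y} ->
  phi (wsplit F i j G s) = wsplit F i j (phi \o G) s.
Proof.
move=> phiD; have phi0 : phi 0 = 0.
  by apply: (addrI (phi 0)); rewrite -phiD !addr0.
have [n] := ubnP (size s); elim: n s i G => // n IHn [|x s] i G /= sn.
  by rewrite !wsplit0; case: ifP.
rewrite !wsplit_cons (big_morph phi phiD phi0) [LHS]big_seq [RHS]big_seq.
apply: eq_bigr => p /size_cuts ps; rewrite (big_morph phi phiD phi0).
by apply: eq_bigr => k _; rewrite IHn // (leq_ltn_trans _ (sn : size s < n)%N) // -ps leq_addl.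
Qed.

(** Splitting into blocks and then grouping consecutive blocks amounts to splitting into groups and
    then splitting each group. At the end of a group both paths stand at a definite index, hence the
    product [I * J]. Multiadditivity of [G] pulls the sum over the inner splittings out of each
    letter. *)
Lemma wsplit_comp (V : eqType) (W X M : zmodType) (I J : finType)
    (A : I -> I -> seq V -> W) (F : J -> J -> seq W -> X) (G : seq X -> M)
    (i j : I) (i' j' : J) s :
  multiadd G ->
  wsplit A i j (wsplit F i' j' G) s
  = wsplit (fun u v => wsplit A u.1 v.1 (F u.2 v.2)) (i, i') (j, j') G s.
Proof.
have [n] := ubnP (size s); elim: n s i i' G => // n IHn [|x s] i i' G /= sn Gadd.
  by rewrite !wsplit0 xpair_eqE; case: (i == j).
rewrite !wsplit_cons.
(* The contribution of the remaining word [t] once the first outer block has produced the letter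
   [v]; its additivity in [v] is what allows the inner sums to be exchanged. *)
pose Phi l k' (v : X) t := wsplit (fun u v => wsplit A u.1 v.1 (F u.2 v.2))
  (l, k') (j, j') (fun w => G (v :: w)) t.
have PhiD l k' t : {morph (fun v => Phi l k' v t) : v v' / v + v'}.
  by move=> v v'; apply: wsplit_multiadd_head.
have step k v t : (size t <= size s)%N ->
    wsplit A k j (fun w => wsplit F i' j' G (v :: w)) t
    = \sum_(q <- cuts t) \sum_(u : I * J)
        Phi u.1 u.2 (wsplit A k u.1 (fun a => F i' u.2 (v :: a)) q.1) q.2.
  move=> ts; under eq_wsplitr do rewrite wsplit_cons.
  rewrite (wsplit_cuts _ _ _ (fun a c => \sum_k'
    wsplit F k' j' (fun w => G (F i' k' (v :: a) :: w)) c)).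
  rewrite [LHS]big_seq [RHS]big_seq; apply: eq_bigr => q /size_cuts qt.
  rewrite -(pair_big xpredT xpredT (fun l k' =>
    Phi l k' (wsplit A k l (fun a => F i' k' (v :: a)) q.1) q.2)) /=.
  apply: eq_bigr => l _.
  under eq_bigr => k' _ do rewrite (wsplit_additive _ _ _ _ _ (PhiD l k' q.2)).
  rewrite -wsplit_sum; apply: eq_wsplitr => a; rewrite wsplit_sum.
  apply: eq_bigr => k' _; rewrite IHn //; last exact: multiadd_cons.
  by rewrite (leq_ltn_trans _ (sn : size s < n)%N) // (leq_trans _ ts) // -qt leq_addl.
transitivity (\sum_(p <- cuts s) \sum_(q <- cuts p.2) \sum_(u : I * J) \sum_k
    Phi u.1 u.2 (wsplit A k u.1 (fun a => F i' u.2 (A i k (x :: p.1) :: a)) q.1) q.2).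
  rewrite [LHS]big_seq [RHS]big_seq; apply: eq_bigr => p /size_cuts ps.
  under eq_bigr => k _ do rewrite step -?ps ?leq_addl //.
  by rewrite exchange_big; apply: eq_bigr => q _; apply: exchange_big.
rewrite -(cuts_coassoc _ (fun a b c => \sum_(u : I * J) \sum_k
  Phi u.1 u.2 (wsplit A k u.1 (fun w => F i' u.2 (A i k (x :: a) :: w)) b) c)).
apply: eq_bigr => p _; rewrite exchange_big; apply: eq_bigr => -[l k'] _ /=.
rewrite wsplit_cons -/(Phi l k' _ p.2).
have Phi0 : Phi l k' 0 p.2 = 0 by apply: (addrI (Phi l k' 0 p.2)); rewrite -PhiD !addr0.
rewrite (big_morph (fun v => Phi l k' v p.2) (PhiD l k' p.2) Phi0).
by apply: eq_bigr => q _; rewrite (big_morph (fun v => Phi l k' v p.2) (PhiD l k' p.2) Phi0).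
Qed.

(** A path that leaves the image of [r] has a zero letter, and a multiadditive [G] kills it. This
    trims the product index sets of [wsplit_comp] down to [unit] or [bool]. *)
Lemma wsplit_sub (V : eqType) (W M : zmodType) (I K : finType) (r : K -> I)
    (F : I -> I -> seq V -> W) (G : seq W -> M) k l s :
  injective r ->
  (forall k i a, i \notin codom r -> F (r k) i a = 0) -> multiadd G ->
  wsplit F (r k) (r l) G s = wsplit (fun u v => F (r u) (r v)) k l G s.
Proof.
move=> r_inj F0; have [n] := ubnP (size s).
elim: n s k G => // n IHn [|x s] k G /= sn Gadd; first by rewrite !wsplit0 inj_eq.
rewrite !wsplit_cons [LHS]big_seq [RHS]big_seq; apply: eq_bigr => p /size_cuts ps.
rewrite (bigID (mem (codom r))) /= [X in _ + X]big1 => [|i ri].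
  rewrite addr0 -big_uniq; last by rewrite map_inj_uniq ?enum_uniq.
  rewrite big_map big_enum /=; apply: eq_bigr => k' _.
  rewrite IHn //; last exact: multiadd_cons.
  by rewrite (leq_ltn_trans _ (sn : size s < n)%N) // -ps leq_addl.
rewrite F0 // -[RHS](wsplit_zero F i (r l) p.2); apply: eq_wsplitr => w.
exact: (multiadd0 [::]).
Qed.

End Composition.

(** * Morphisms and coderivations as triangular weights *)

Section Blocks.
Variables (V : eqType) (W M : zmodType).
Implicit Types (F A E B : seq V -> W) (G : seq W -> M) (s : seq V).

(* The pullback of [G] along the coalgebra morphism with components [F]. *)
Definition blocks F G s := wsplit (fun _ _ : unit => F) tt tt G s.

(** The state records whether the marked block has been passed, so a path from [false] to [true]
    meets [E] exactly once; going back has weight 0. *)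
Definition trimx A E B : bool -> bool -> seq V -> W := fun i j =>
  if i then (if j then B else fun=> 0) else (if j then E else A).

(* The pullback of [G] along the [(A, B)]-coderivation with components [E]: the
   sum of all [G (A s_1, ..., A s_{i-1}, E s_i, B s_{i+1}, ..., B s_k)].  The
   sign of an odd [E] has to be included in [A]. *)
Definition coder A E B G s := wsplit (trimx A E B) false true G s.

(** Two successive marks need three states; they are placed on the square [bool * bool] because
    [wsplit_comp] applied to two coderivations produces that index set. *)
Definition trimx2 A0 E1 A1 E2 A2 : bool * bool -> bool * bool -> seq V -> W :=
  fun i j => match i, j with
  | (false, false), (false, false) => A0
  | (false, false), (true, false) => E1
  | (true, false), (true, false) => A1
  | (true, false), (true, true) => E2
  | (true, true), (true, true) => A2
  | _, _ => fun=> 0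
  end.

Definition coder2 A0 E1 A1 E2 A2 G s :=
  wsplit (trimx2 A0 E1 A1 E2 A2) (false, false) (true, true) G s.

Lemma big_unit (f : unit -> M) : \sum_i f i = f tt.
Proof. by rewrite (bigD1 tt) //= big1 ?addr0 // => -[]. Qed.

Lemma big_bool2 (f : bool * bool -> M) : \sum_i f i
  = f (true, true) + f (true, false) + (f (false, true) + f (false, false)).
Proof.
transitivity (\sum_i \sum_j f (i, j)); last by rewrite !big_bool.
by rewrite pair_big; apply: eq_bigr => -[].
Qed.

Lemma blocks0 F G : blocks F G [::] = G [::].
Proof. by []. Qed.

Lemma blocks_cons F G x s : blocks F G (x :: s) =
  \sum_(p <- cuts s) blocks F (fun w => G (F (x :: p.1) :: w)) p.2.
Proof. by rewrite /blocks wsplit_cons; apply: eq_bigr => p _; rewrite big_unit. Qed.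

Lemma wsplit_trimx_tt A E B G s : multiadd G ->
  wsplit (trimx A E B) true true G s = blocks B G s.
Proof.
move=> Gadd; rewrite (@wsplit_sub _ _ _ _ unit (fun=> true) _ _ tt tt) //.
- by case=> -[].
- move=> _ [] a //; case/negP; exact: (codom_f (fun=> true) tt).
Qed.

Lemma wsplit_trimx_tf A E B G s : multiadd G ->
  wsplit (trimx A E B) true false G s = 0.
Proof.
have [n] := ubnP (size s); elim: n s G => // n IHn [|x s] G /= sn Gadd //.
rewrite wsplit_cons big_seq big1 // => p /size_cuts ps; rewrite big_bool /=.
rewrite IHn ?add0r; last exact: multiadd_cons; last first.
  by rewrite (leq_ltn_trans _ (sn : size s < n)%N) // -ps leq_addl.
rewrite -[RHS](wsplit_zero (trimx A E B) false false p.2).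
by apply: eq_wsplitr => w; apply: (multiadd0 [::]).
Qed.

Lemma wsplit_trimx_ff A E B G s : multiadd G ->
  wsplit (trimx A E B) false false G s = blocks A G s.
Proof.
have [n] := ubnP (size s); elim: n s G => // n IHn [|x s] G /= sn Gadd //.
rewrite wsplit_cons blocks_cons [LHS]big_seq [RHS]big_seq.
apply: eq_bigr => p /size_cuts ps; rewrite big_bool /=.
rewrite wsplit_trimx_tf ?add0r; last exact: multiadd_cons.
rewrite IHn //; last exact: multiadd_cons.
by rewrite (leq_ltn_trans _ (sn : size s < n)%N) // -ps leq_addl.
Qed.

Lemma coder0 A E B G : coder A E B G [::] = 0.
Proof. by []. Qed.

Lemma coder_cons A E B G x s : multiadd G ->
  coder A E B G (x :: s) = \sum_(p <- cuts s)
    (coder A E B (fun w => G (A (x :: p.1) :: w)) p.2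
     + blocks B (fun w => G (E (x :: p.1) :: w)) p.2).
Proof.
move=> Gadd; rewrite /coder wsplit_cons; apply: eq_bigr => p _.
by rewrite big_bool addrC /= wsplit_trimx_tt //; apply: multiadd_cons.
Qed.

Lemma wsplit_head0 (I : finType) (F : I -> I -> seq V -> W) G i j s :
  multiadd G -> wsplit F i j (fun w => G (0 :: w)) s = 0.
Proof.
move=> Gadd; rewrite -[RHS](wsplit_zero F i j s); apply: eq_wsplitr => w.
exact: (multiadd0 [::]).
Qed.

Lemma coder2_cons A0 E1 A1 E2 A2 G x s : multiadd G ->
  coder2 A0 E1 A1 E2 A2 G (x :: s) = \sum_(p <- cuts s)
    (coder2 A0 E1 A1 E2 A2 (fun w => G (A0 (x :: p.1) :: w)) p.2
     + coder A1 E2 A2 (fun w => G (E1 (x :: p.1) :: w)) p.2).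
Proof.
move=> Gadd; rewrite /coder2 wsplit_cons; apply: eq_bigr => p _.
rewrite big_bool2 /= !wsplit_head0 // !add0r addrC; congr (_ + _).
rewrite (@wsplit_sub _ _ _ _ _ (pair true) _ _ false true).
- by apply: eq_wsplit => // -[] [].
- by move=> k l [].
- by move=> [] [[] []] a //; case/negP; apply: (codom_f (pair true)).
- exact: multiadd_cons.
Qed.

(* A path from (false, false) to (true, true) jumps directly, or passes through
   (true, false) or (false, true). *)
Lemma wsplit_square (F : bool * bool -> bool * bool -> seq V -> W) G s :
  (forall a, [/\ F (true, false) (false, false) a = 0,
     F (true, false) (false, true) a = 0, F (false, true) (false, false) a = 0,
     F (false, true) (true, false) a = 0 & F (true, true) (true, false) a = 0
     /\ F (true, true) (false, true) a = 0 /\ F (true, true) (false, false) a = 0]) ->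
  multiadd G ->
  wsplit F (false, false) (true, true) G s
  = coder (F (false, false) (false, false)) (F (false, false) (true, true))
      (F (true, true) (true, true)) G s
    + coder2 (F (false, false) (false, false)) (F (false, false) (true, false))
        (F (true, false) (true, false)) (F (true, false) (true, true))
        (F (true, true) (true, true)) G s
    + coder2 (F (false, false) (false, false)) (F (false, false) (false, true))
        (F (false, true) (false, true)) (F (false, true) (true, true))
        (F (true, true) (true, true)) G s.
Proof.
move=> F0; have [n] := ubnP (size s).
elim: n s G => // n IHn [|x s] G /= sn Gadd; first by rewrite wsplit0 !addr0.
rewrite wsplit_cons coder_cons // !coder2_cons // -!big_split /=.
rewrite [LHS]big_seq [RHS]big_seq; apply: eq_bigr => p /size_cuts ps.
have Gv v := multiadd_cons v Gadd.
rewrite big_bool2 IHn //; last first.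
  by rewrite (leq_ltn_trans _ (sn : size s < n)%N) // -ps leq_addl.
have -> v : wsplit F (true, true) (true, true) (fun w => G (v :: w)) p.2
    = blocks (F (true, true) (true, true)) (fun w => G (v :: w)) p.2.
  rewrite (@wsplit_sub _ _ _ _ unit (fun=> (true, true)) _ _ tt tt) //.
    by case=> -[].
  move=> _ [[] []] a; rewrite ?(codom_f (fun=> (true, true)) tt) //;
    by case: (F0 a) => ? ? ? ? [? []].
have -> v : wsplit F (true, false) (true, true) (fun w => G (v :: w)) p.2
    = coder (F (true, false) (true, false)) (F (true, false) (true, true))
        (F (true, true) (true, true)) (fun w => G (v :: w)) p.2.
  rewrite (@wsplit_sub _ _ _ _ _ (pair true) _ _ false true) //.
  - by apply: eq_wsplit => // -[] [] // a _ _; case: (F0 a) => ? ? ? ? [? []].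
  - by move=> k l [].
  - move=> [] [[] []] a; rewrite ?(codom_f (pair true)) //;
      by case: (F0 a) => ? ? ? ? [? []].
have -> v : wsplit F (false, true) (true, true) (fun w => G (v :: w)) p.2
    = coder (F (false, true) (false, true)) (F (false, true) (true, true))
        (F (true, true) (true, true)) (fun w => G (v :: w)) p.2.
  rewrite (@wsplit_sub _ _ _ _ _ (fun b => (b, true)) _ _ false true) //.
  - by apply: eq_wsplit => // -[] [] // a _ _; case: (F0 a) => ? ? ? ? [? []].
  - by move=> k l [].
  - move=> [] [[] []] a; rewrite ?(codom_f (fun b => (b, true))) //;
      by case: (F0 a) => ? ? ? ? [? []].
by rewrite [LHS]addrC [LHS](AC (1*3*2) ((2*5)*(3*6)*(4*1))).
Qed.

Lemma eq_coder A E B A' E' B' G s :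
  (forall a, a != [::] -> (size a <= size s)%N ->
     [/\ A a = A' a, E a = E' a & B a = B' a]) ->
  coder A E B G s = coder A' E' B' G s.
Proof.
by move=> e; apply: eq_wsplit => // -[] [] a a0 as_ //=; case: (e a).
Qed.

Lemma eq_coderE A E E' B G s :
  (forall a, a != [::] -> (size a <= size s)%N -> E a = E' a) ->
  coder A E B G s = coder A E' B G s.
Proof. by move=> e; apply: eq_coder => a a0 /e -> //. Qed.

Lemma eq_blocks F F' G s :
  (forall a, a != [::] -> (size a <= size s)%N -> F a = F' a) ->
  blocks F G s = blocks F' G s.
Proof. by move=> e; apply: eq_wsplit. Qed.

End Blocks.

(** * Composites of morphisms and coderivations *)

Section Compositions.
Variables (V : eqType) (W X M : zmodType).
Variables (G : seq X -> M) (Gadd : multiadd G).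

Lemma blocks_blocks (A : seq V -> W) (F : seq W -> X) s :
  blocks A (blocks F G) s = blocks (blocks A F) G s.
Proof.
rewrite /blocks wsplit_comp //.
rewrite (@wsplit_sub _ _ _ _ unit (fun=> (tt, tt)) _ _ tt tt) //.
- by move=> [] [].
- by move=> k [[] []] a; rewrite (codom_f (fun=> (tt, tt)) tt).
Qed.

Lemma coder_blocks (A E B : seq V -> W) (F : seq W -> X) s : multiadd F ->
  coder A E B (blocks F G) s
  = coder (blocks A F) (coder A E B F) (blocks B F) G s.
Proof.
move=> Fadd; rewrite /coder {1}/blocks wsplit_comp //.
rewrite (@wsplit_sub _ _ _ _ bool (fun b => (b, tt)) _ _ false true) //.
- apply: eq_wsplit => // -[] [] a _ _ //=.
  + exact: wsplit_trimx_tt.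
  + exact: wsplit_trimx_tf.
  + exact: wsplit_trimx_ff.
- by move=> ? ? [].
- by move=> k [b []] a /=; rewrite (codom_f (fun b => (b, tt))).
Qed.

Lemma blocks_coder (F : seq V -> W) (A E B : seq W -> X) s :
  blocks F (coder A E B G) s
  = coder (blocks F A) (blocks F E) (blocks F B) G s.
Proof.
rewrite {1}/blocks /coder wsplit_comp //.
rewrite (@wsplit_sub _ _ _ _ bool (fun b => (tt, b)) _ _ false true) //.
- by apply: eq_wsplit => // -[] [] a _ _ //=; apply: wsplit_zero.
- by move=> ? ? [].
- by move=> k [[] b] a /=; rewrite (codom_f (fun b => (tt, b))).
Qed.

(** The three summands correspond to the position of [E] relative to the outer block marked by [E']:
    inside it, in an earlier block, or in a later one. *)
Lemma coder_coder (A E B : seq V -> W) (A' E' B' : seq W -> X) s :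
  multiadd A' -> multiadd E' -> multiadd B' ->
  coder A E B (coder A' E' B' G) s
  = coder (blocks A A') (coder A E B E') (blocks B B') G s
    + coder2 (blocks A A') (coder A E B A') (blocks B A') (blocks B E')
        (blocks B B') G s
    + coder2 (blocks A A') (blocks A E') (blocks A B') (coder A E B B')
        (blocks B B') G s.
Proof.
move=> A'add E'add B'add; rewrite {1 2}/coder wsplit_comp // wsplit_square //.
  congr (_ + _ + _).
  - apply: eq_coder => a _ _; split; first exact: wsplit_trimx_ff.
      by [].
    exact: wsplit_trimx_tt.
  - apply: eq_wsplit => [i j a _ _|//].
    by case: i j => [[] []] [[] []] //=; rewrite ?wsplit_trimx_ff ?wsplit_trimx_tt.
  - apply: eq_wsplit => [i j a _ _|//].
    by case: i j => [[] []] [[] []] //=; rewrite ?wsplit_trimx_ff ?wsplit_trimx_tt.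
by move=> a; do !split; rewrite /= ?wsplit_zero ?wsplit_trimx_tf.
Qed.

End Compositions.

(** * Linearity in the marked component, and vanishing by length *)

Section Linearity.
Variables (V : eqType) (W M : zmodType).
Implicit Types (F A E B : seq V -> W) (G : seq W -> M) (s : seq V).

Lemma coderD A E E' B G s : multiadd G ->
  coder A (fun a => E a + E' a) B G s = coder A E B G s + coder A E' B G s.
Proof.
have [n] := ubnP (size s); elim: n s G => // n IHn [|x s] G /= sn Gadd.
  by rewrite !coder0 addr0.
rewrite !coder_cons // -big_split [LHS]big_seq [RHS]big_seq /=.
apply: eq_bigr => p /size_cuts ps; rewrite IHn.
- by rewrite {1}/blocks wsplit_multiadd_head // addrACA.
- by rewrite (leq_ltn_trans _ (sn : size s < n)%N) // -ps leq_addl.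
- exact: multiadd_cons.
Qed.

Lemma coder_eq0 A E B G s : multiadd G ->
  (forall a, a != [::] -> (size a <= size s)%N -> E a = 0) ->
  coder A E B G s = 0.
Proof.
move=> Gadd E0.
rewrite (@eq_coderE _ _ _ _ _ (fun=> 0)) //.
apply: (addrI (coder A (fun=> 0) B G s)); rewrite addr0 -coderD //.
by apply: eq_coderE => a _ _; rewrite addr0.
Qed.

Lemma coderB A E E' B G s : multiadd G ->
  coder A (fun a => E a - E' a) B G s = coder A E B G s - coder A E' B G s.
Proof.
move=> Gadd; apply: (addIr (coder A E' B G s)); rewrite -coderD // subrK.
by apply: eq_coderE => a _ _; rewrite subrK.
Qed.

Lemma coder2D A0 E1 E1' A1 E2 A2 G s : multiadd G ->
  coder2 A0 (fun a => E1 a + E1' a) A1 E2 A2 G s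
  = coder2 A0 E1 A1 E2 A2 G s + coder2 A0 E1' A1 E2 A2 G s.
Proof.
have [n] := ubnP (size s); elim: n s G => // n IHn [|x s] G /= sn Gadd.
  by rewrite /coder2 !wsplit0 addr0.
rewrite !coder2_cons // -big_split [LHS]big_seq [RHS]big_seq /=.
apply: eq_bigr => p /size_cuts ps; rewrite IHn.
- by rewrite {1}/coder wsplit_multiadd_head // addrACA.
- by rewrite (leq_ltn_trans _ (sn : size s < n)%N) // -ps leq_addl.
- exact: multiadd_cons.
Qed.

Lemma eq_coder2 A0 E1 A1 E2 A2 A0' E1' A1' E2' A2' G s :
  (forall a, a != [::] -> [/\ A0 a = A0' a, E1 a = E1' a, A1 a = A1' a,
     E2 a = E2' a & A2 a = A2' a]) ->
  coder2 A0 E1 A1 E2 A2 G s = coder2 A0' E1' A1' E2' A2' G s.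
Proof.
move=> e; apply: eq_wsplit => // i j a a0 _; case: (e a a0) => *.
by case: i j => [[] []] [[] []].
Qed.

(** If the marked block is the whole word, [G] receives a single letter and vanishes; otherwise the
    block is proper and [E] vanishes on it. This is how a defect on [s] is reduced to defects on
    shorter words. *)
Lemma coder_eq0_lt A E B G s : multiadd G -> (forall v, G [:: v] = 0) ->
  (forall a, a != [::] -> (size a < size s)%N -> E a = 0) ->
  coder A E B G s = 0.
Proof.
case: s => [|x s] // Gadd G1 E0; rewrite coder_cons // big_seq big1 // => p /size_cuts ps.
have [->|p20] := eqVneq p.2 [::]; first by rewrite coder0 blocks0 G1 add0r.
have ltp a : (size a + size p.2 <= size s)%N -> (size a < (size s))%N.
  by apply: leq_trans; rewrite -addn1 leq_add2l lt0n size_eq0.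
rewrite E0 //= ?ltnS ?ltp ?ps // /blocks wsplit_head0 // addr0.
apply: coder_eq0; first exact: multiadd_cons.
by move=> a a0 ap; rewrite E0 //= ltnS (leq_trans ap) // -ps leq_addl.
Qed.

(** The block of [E2] takes at least one letter, so that of [E1] is always proper, whatever [G] does
    on single letters. *)
Lemma coder2_eq0_lt A0 E1 A1 E2 A2 G s : multiadd G ->
  (forall a, a != [::] -> (size a < size s)%N -> E1 a = 0) ->
  coder2 A0 E1 A1 E2 A2 G s = 0.
Proof.
have [n] := ubnP (size s); elim: n s G => // n IHn [|x s] G //= sn Gadd E0.
rewrite coder2_cons // big_seq big1 // => p /size_cuts ps.
rewrite IHn ?add0r.
- have [->|p20] := eqVneq p.2 [::]; first by rewrite coder0.
  rewrite E0 /coder ?wsplit_head0 //= ltnS -ps -addn1 leq_add2l.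
  by rewrite lt0n size_eq0.
- by rewrite (leq_ltn_trans _ (sn : size s < n)%N) // -ps leq_addl.
- exact: multiadd_cons.
- by move=> a a0 ap; rewrite E0 // ltnS ltnW // (leq_trans ap) // -ps leq_addl.
Qed.

(** Telescoping: changing [A] into [B] one block at a time, from the right, leaves [A] before the
    changed block and [B] after it. *)
Lemma blocksB A B G s : multiadd G ->
  blocks A G s - blocks B G s = coder A (fun a => A a - B a) B G s.
Proof.
have [n] := ubnP (size s); elim: n s G => // n IHn [|x s] G /= sn Gadd.
  by rewrite !blocks0 subrr.
rewrite !blocks_cons coder_cons // -sumrB [LHS]big_seq [RHS]big_seq.
apply: eq_bigr => p /size_cuts ps; rewrite -IHn.
- have -> u v : blocks B (fun w => G (u - v :: w)) p.2
      = blocks B (fun w => G (u :: w)) p.2 - blocks B (fun w => G (v :: w)) p.2.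
    apply: (addIr (blocks B (fun w => G (v :: w)) p.2)).
    by rewrite subrK /blocks -wsplit_multiadd_head // subrK.
  by rewrite addrA subrK.
- by rewrite (leq_ltn_trans _ (sn : size s < n)%N) // -ps leq_addl.
- exact: multiadd_cons.
Qed.

End Linearity.

(** * Components concentrated on one-letter words *)

Section Unary.

(** Unlike [unary], this vanishes on all words of length other than one, which makes it
    multiadditive for additive [phi]. As [G] it projects to the cogenerators; as a component it
    gives a strict morphism. *)
Definition unary1 (U : Type) (M : zmodType) (phi : U -> M) (w : seq U) : M :=
  if w is [:: v] then phi v else 0.

Lemma big_cuts_last (V : eqType) (M : zmodType) (H : seq V * seq V -> M) s :
  (forall p, p.2 != [::] -> H p = 0) -> \sum_(p <- cuts s) H p = H (s, [::]).
Proof.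
elim: s H => [|x s IHs] H H0; first by rewrite big_cuts0.
by rewrite big_cuts_cons H0 // add0r IHs // => p p20; apply: H0.
Qed.

Lemma big_cuts_first (V : eqType) (M : zmodType) (H : seq V * seq V -> M) s :
  (forall p, p.1 != [::] -> H p = 0) -> \sum_(p <- cuts s) H p = H ([::], s).
Proof.
case: s => [|x s] H0; first by rewrite big_cuts0.
by rewrite big_cuts_cons big1 ?addr0 // => p _; apply: H0.
Qed.

Variables (V : eqType) (W M : zmodType).
Implicit Types (F A E B : seq V -> W) (G : seq W -> M) (s : seq V).

Lemma multiadd_unary1 (phi : W -> M) :
  {morph phi : x y / x + y} -> multiadd (unary1 phi).
Proof.
move=> phiD [|u s] [|v t] x y /=; rewrite ?addr0 //.
by case: s => [|u' s] /=; rewrite addr0.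
by case: s => [|u' s] /=; rewrite addr0.
Qed.

Lemma wsplit_unary1 (I : finType) (F : I -> I -> seq V -> W) i j (phi : W -> M) s :
  s != [::] -> wsplit F i j (unary1 phi) s = phi (F i j s).
Proof.
case: s => // x s _; rewrite wsplit_cons big_cuts_last => [|p p20].
  rewrite (bigD1 j) //= big1 ?addr0 => [|k /negPf kj]; rewrite wsplit0 ?eqxx //=.
  by rewrite kj.
rewrite big1 // => k _; rewrite -[RHS](wsplit_zero F k j p.2).
apply: eq_wsplit => // w _; rewrite (negPf p20); by case: w.
Qed.

Lemma blocks_unary1 F (phi : W -> M) s :
  s != [::] -> blocks F (unary1 phi) s = phi (F s).
Proof. exact: wsplit_unary1. Qed.

Lemma coder_unary1 A E B (phi : W -> M) s :
  s != [::] -> coder A E B (unary1 phi) s = phi (E s).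
Proof. exact: wsplit_unary1. Qed.

Lemma unary1_blocks (phi : V -> W) G s :
  multiadd G -> blocks (unary1 phi) G s = G (map phi s).
Proof.
elim: s G => [|x s IHs] G Gadd //; rewrite blocks_cons big_cuts_first => [|p p10].
  by rewrite IHs //; apply: multiadd_cons.
by case: p.1 p10 => //= a b _; rewrite /blocks wsplit_head0.
Qed.

Lemma blocks_comp (U : zmodType) F (phi : W -> U) (G : seq U -> M) s :
  blocks (phi \o F) G s = blocks F (G \o map phi) s.
Proof.
have [n] := ubnP (size s); elim: n s G => // n IHn [|x s] G //= sn.
rewrite !blocks_cons [LHS]big_seq [RHS]big_seq; apply: eq_bigr => p /size_cuts ps.
by rewrite IHn // (leq_ltn_trans _ (sn : size s < n)%N) // -ps leq_addl.
Qed.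

Lemma blocks_map (U : eqType) F (phi : U -> V) G (s : seq U) :
  blocks F G (map phi s) = blocks (F \o map phi) G s.
Proof.
have [n] := ubnP (size s); elim: n s G => // n IHn [|x s] G //= sn.
rewrite !blocks_cons cuts_map big_map [LHS]big_seq [RHS]big_seq.
apply: eq_bigr => p /size_cuts ps.
by rewrite /= IHn // (leq_ltn_trans _ (sn : size s < n)%N) // -ps leq_addl.
Qed.

Lemma blocks_add F G G' s :
  blocks F (fun w => G w + G' w) s = blocks F G s + blocks F G' s.
Proof. exact: wsplitD. Qed.

Lemma coder_add A E B G G' s :
  coder A E B (fun w => G w + G' w) s = coder A E B G s + coder A E B G' s.
Proof. exact: wsplitD. Qed.

Lemma blocks_additive (M' : zmodType) (phi : M -> M') F G s :
  {morph phi : x y / x + y} -> blocks F (phi \o G) s = phi (blocks F G s).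
Proof. by move=> phiD; symmetry; apply: wsplit_additive. Qed.

Lemma coder_additive (M' : zmodType) (phi : M -> M') A E B G s :
  {morph phi : x y / x + y} -> coder A E B (phi \o G) s = phi (coder A E B G s).
Proof. by move=> phiD; symmetry; apply: wsplit_additive. Qed.

End Unary.

(** * Homotopy transfer without signs *)

Lemma eq_blocksr (V : eqType) (W M : zmodType) (F : seq V -> W)
    (G G' : seq W -> M) s :
  s != [::] -> (forall w, w != [::] -> G w = G' w) -> blocks F G s = blocks F G' s.
Proof. by move=> /negPf s0 e; apply: eq_wsplit => // w _; rewrite s0 => /negbT/e. Qed.

Lemma eq_coderr (V : eqType) (W M : zmodType) (A E B : seq V -> W)
    (G G' : seq W -> M) s :
  s != [::] -> (forall w, w != [::] -> G w = G' w) ->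
  coder A E B G s = coder A E B G' s.
Proof. by move=> /negPf s0 e; apply: eq_wsplit => // w _; rewrite s0 => /negbT/e. Qed.

(* All maps are conjugated by the suspension: structure maps become odd and
   morphisms even with respect to the grading involutions [tau], and no other
   signs are left. *)
Section SuspendedTransfer.
Variables (V W : zmodType).
Variables (tau d h : {additive V -> V}) (tauW dW : {additive W -> W}).
Variables (f : {additive V -> W}) (g : {additive W -> V}).
Variables (b' p P q chi : seq V -> V).

Let id1 : seq V -> V := unary1 id.
Let b s := unary1 d s + b' s.
Let D (M : zmodType) := @coder V V M (unary1 tau) b id1.

Hypothesis tauK : involutive tau.
Hypothesis d_tau : forall x, d (tau x) = - tau (d x).
Hypothesis h_tau : forall x, h (tau x) = - tau (h x).
Hypothesis f_tau : forall x, f (tau x) = tauW (f x).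
Hypothesis g_tau : forall x, g (tauW x) = tau (g x).
Hypothesis dd : forall x, d (d x) = 0.
Hypothesis dWdW : forall x, dW (dW x) = 0.
Hypothesis f_d : forall x, dW (f x) = f (d x).
Hypothesis g_d : forall x, d (g x) = g (dW x).
Hypothesis htpy : forall x, g (f x) - x = d (h x) + h (d x).

Hypothesis b'_add : multiadd b'.
Hypothesis b'_letter : forall v, b' [:: v] = 0.
Hypothesis b'_tau : forall s, s != [::] -> b' (map tau s) = - tau (b' s).
Hypothesis D_b : forall s, s != [::] -> D b s = 0.

Hypothesis P_add : multiadd P.
Hypothesis pE : forall s, s != [::] -> p s = blocks P b' s.
Hypothesis PE : forall s, s != [::] -> P s = id1 s + h (p s).
Hypothesis P_tau : forall s, s != [::] -> P (map tau s) = tau (P s).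

Hypothesis q_add : multiadd q.
Hypothesis chi_add : multiadd chi.
Hypothesis qE : forall s, s != [::] ->
  q s = id1 s + coder (tau \o chi) (h \o q) id1 b' s.
Hypothesis chiE : forall s, s != [::] -> chi s = blocks (g \o f \o q) P s.
Hypothesis q_tau : forall s, s != [::] -> q (map tau s) = tau (q s).
Hypothesis chi_tau : forall s, s != [::] -> chi (map tau s) = tau (chi s).

(** * The transferred structure and the morphism psi *)

Definition susp_psi s := P (map g s).
Definition susp_nu s := f (p (map g s)).
Let Psi := susp_psi.
Let nu := susp_nu.
Let bW s := unary1 dW s + nu s.
Let DW (M : zmodType) := @coder W W M (unary1 tauW) bW (unary1 id).

Let id1_add : multiadd id1.
Proof. by apply: multiadd_unary1. Qed.

Let map_neq0 (T T' : eqType) (phi : T -> T') s : (map phi s != [::]) = (s != [::]).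
Proof. by case: s. Qed.

(** Splitting [b] in [D b = 0], the linear part contributes [d (b s)], which is [d (b' s)] because
    [d] squares to zero. *)
Lemma D_b' s : s != [::] -> D b' s = - d (b' s).
Proof.
move=> s0; apply/eqP; rewrite -addr_eq0 addrC; apply/eqP.
have := D_b s0; rewrite /D {2}/b coder_add coder_unary1 // /b raddfD.
suff -> : d (unary1 d s) = 0 by rewrite add0r.
by case: s s0 => // x [|y s] _ /=; rewrite ?dd ?raddf0.
Qed.

Lemma Psi_add : multiadd Psi.
Proof. by move=> s t x y; rewrite /Psi /susp_psi !map_cat /= raddfD P_add. Qed.

Lemma Psi_tau s : s != [::] -> Psi (map tauW s) = tau (Psi s).
Proof.
move=> s0; rewrite /Psi /susp_psi -P_tau ?map_neq0 // -!map_comp.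
by congr P; apply: eq_map => x /=; rewrite g_tau.
Qed.

Lemma p_Psi s : s != [::] -> p (map g s) = blocks Psi b' s.
Proof. by move=> s0; rewrite pE ?map_neq0 // blocks_map. Qed.

Lemma PsiE s : s != [::] -> Psi s = unary1 g s + h (blocks Psi b' s).
Proof.
move=> s0; rewrite -p_Psi // /Psi /susp_psi PE ?map_neq0 //; congr (_ + _).
by case: s s0 => // x [|y s].
Qed.

Lemma unary1_comp (T T' : zmodType) (u : {additive V -> T'}) (phi : T -> V) s :
  u (unary1 phi s) = unary1 (u \o phi) s.
Proof. by case: s => [|x [|y s]] /=; rewrite ?raddf0. Qed.

Lemma D_W_blocks_Psi s : s != [::] ->
  DW (blocks Psi b') s = coder (tau \o Psi) (DW Psi) Psi b' s.
Proof.
move=> s0; rewrite /DW coder_blocks //; last exact: Psi_add.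
apply: eq_coder => a a0 _; split => //.
  by rewrite unary1_blocks ?Psi_tau //; apply: Psi_add.
by rewrite unary1_blocks ?map_id //; apply: Psi_add.
Qed.

(** The counterpart of [D_W_blocks_Psi]: the difference of the two is [b'] applied with the morphism
    defect of [Psi] in the marked block. *)
Lemma blocks_Psi_D_b' s : s != [::] ->
  coder (tau \o Psi) (blocks Psi b) Psi b' s = - d (blocks Psi b' s).
Proof.
move=> s0; transitivity (blocks Psi (D b') s).
  rewrite /D blocks_coder //.
  by apply: eq_coder => a a0 _; rewrite !blocks_unary1.
rewrite (@eq_blocksr _ _ _ _ _ ((-%R \o d) \o b')) => [|//|w w0]; last exact: D_b'.
by rewrite blocks_additive // => x y; rewrite raddfD.
Qed.

Lemma Psi_morphism s : s != [::] -> blocks Psi b s = DW Psi s.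
Proof.
have [n] := ubnP (size s); elim: n s => // n IHn s sn s0.
apply/eqP; rewrite -subr_eq0; apply/eqP.
(* By induction the defect vanishes on proper blocks, and [b'] vanishes on single letters. *)
have E0 : coder (tau \o Psi) (fun a => blocks Psi b a - DW Psi a) Psi b' s = 0.
  apply: coder_eq0_lt => // a a0 as_; rewrite IHn ?subrr //.
  by rewrite (leq_trans as_).
move: E0; rewrite coderB // -D_W_blocks_Psi // blocks_Psi_D_b' //.
set X := blocks Psi b' s => E0.
(* [htpy] at [X] replaces [d (h X)] by [g (f X) - X - h (d X)]. Here [- X] cancels the [b'] part of
   [b], and [g (f X)] is what [nu] contributes to [DW Psi]; only [h] of the quantity in [E0]
   remains. *)
have -> : blocks Psi b s = unary1 (g \o dW) s + g (f X) - h (d X).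
  rewrite /b blocks_add blocks_unary1 // PsiE // raddfD unary1_comp -/X.
  have -> : d (h X) = g (f X) - X - h (d X) by rewrite htpy addrK.
  have -> : unary1 (d \o g) s = unary1 (g \o dW) s.
    by case: (s) => [|x [|]] //=; rewrite g_d.
  by rewrite -!addrA [- h _ + X]addrC addKr.
have -> : DW Psi s = unary1 (g \o dW) s + g (f X) + h (DW (blocks Psi b') s).
  rewrite /DW (eq_coderr _ _ _ s0 PsiE) coder_add coder_unary1 // /bW raddfD.
  rewrite /nu /susp_nu p_Psi // -/X -/(bW _) coder_additive; last exact: raddfD.
  by congr (_ + _ + _); case: (s) => [|x [|y t]] /=; rewrite ?raddf0.
rewrite opprD addrACA subrr add0r -opprD -raddfD.
by rewrite (_ : d X + _ = 0) ?raddf0 ?oppr0 //; apply/oppr_inj; rewrite opprD oppr0.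
Qed.

Lemma DW_blocks_Psi s : s != [::] ->
  DW (blocks Psi b') s = - d (blocks Psi b' s).
Proof.
move=> s0; rewrite D_W_blocks_Psi // -blocks_Psi_D_b' //.
by apply: eq_coderE => a a0 _; rewrite Psi_morphism.
Qed.

Lemma nu_blocks s : s != [::] -> nu s = f (blocks Psi b' s).
Proof. by move=> s0; rewrite /nu /susp_nu p_Psi. Qed.

(** As [nu] is [f] of [blocks Psi b'], the relation is [f] applied to [DW_blocks_Psi], using that
    [f] commutes with the differentials. *)
Lemma nu_Ainf s : s != [::] -> DW bW s = 0.
Proof.
move=> s0; rewrite /DW {2}/bW coder_add coder_unary1 // /bW raddfD.
have -> : dW (unary1 dW s) = 0.
  by case: s s0 => // x [|y s] _ /=; rewrite ?raddf0.
rewrite add0r -/bW (eq_coderr _ _ _ s0 nu_blocks) coder_additive; last exact: raddfD.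
by rewrite -/(DW _) DW_blocks_Psi // nu_blocks // f_d raddfN subrr.
Qed.

(** * The defect of q, and the composite chi *)

Let phi := f \o q.

Lemma chi_blocks s : s != [::] -> chi s = blocks phi Psi s.
Proof. by move=> s0; rewrite chiE // -blocks_comp. Qed.

Lemma blocks_chi G s : multiadd G -> s != [::] ->
  blocks (g \o f \o q) (blocks P G) s = blocks chi G s :> V.
Proof.
move=> Gadd s0; rewrite blocks_blocks //.
by apply: eq_blocks => a a0 _; rewrite chiE.
Qed.

Lemma blocks_p s : s != [::] -> blocks (g \o f \o q) p s = blocks chi b' s.
Proof. by move=> s0; rewrite -blocks_chi //; apply: eq_blocksr. Qed.

Lemma chi_rec s : s != [::] -> chi s = g (f (q s)) + h (blocks chi b' s).
Proof.
move=> s0; rewrite chiE // (eq_blocksr _ s0 PE) blocks_add blocks_unary1 //=.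
by rewrite blocks_additive ?blocks_p //; apply: raddfD.
Qed.

Let E s := d (q s) + blocks chi b' s - D q s.

(** This is [f] applied to the vanishing defect, after [b'] on the blocks of [chi] has been
    rewritten as [p] on those of [g f q]. It is stated at one word because it is used inside the
    induction that proves [E s = 0]. *)
Lemma phi_morphism_at s : s != [::] -> E s = 0 -> blocks phi bW s = D phi s.
Proof.
move=> s0 /eqP; rewrite subr_eq0 => /eqP Es.
rewrite /bW blocks_add blocks_unary1 //= f_d /D coder_additive; last exact: raddfD.
rewrite -/(D q s) -Es raddfD; congr (_ + _).
rewrite -blocks_p // -blocks_additive; last exact: raddfD.
by rewrite (blocks_comp phi g).
Qed.

Lemma chi_morphism_at s : s != [::] ->
  (forall a, a != [::] -> (size a <= size s)%N -> E a = 0) ->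
  blocks chi b s = D chi s.
Proof.
move=> s0 E0; have b_add : multiadd b.
  move=> u v x y; rewrite /b b'_add (multiadd_unary1 (raddfD d)) addrACA //.
have phi_add : multiadd phi by move=> u v x y; rewrite /phi /= q_add raddfD.
rewrite (@eq_blocks _ _ _ _ (blocks phi Psi)) => [|a a0 _]; last exact: chi_blocks.
rewrite /D (eq_coderr _ _ _ s0 chi_blocks).
rewrite -blocks_blocks // (eq_blocksr _ s0 Psi_morphism) /DW.
rewrite blocks_coder ?coder_blocks //; try exact: Psi_add.
apply: eq_coder => a a0 as_; split.
- by rewrite unary1_blocks // blocks_unary1 // /phi /= q_tau.
- by rewrite phi_morphism_at ?E0.
- by rewrite unary1_blocks // blocks_unary1 // map_id.
Qed.

Let K := h \o q.

(** [D K] is [h (D q)], and [D q] is [d q] plus the [b' chi] term up to [E]. By [qE] the [b'] part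
    of the second sum is [q - 1]; [htpy] at [q s] and [chi_rec] then assemble [chi]. *)
Lemma homotopy_at s : s != [::] ->
  D K s + coder (tau \o chi) K id1 b s = chi s - id1 s - h (E s).
Proof.
move=> s0; rewrite /D coder_additive; last exact: raddfD.
rewrite -/(D q s) /b coder_add coder_unary1 //= chi_rec //.
have -> : coder (tau \o chi) K id1 b' s = q s - id1 s by rewrite [in RHS]qE // addrC addKr.
have -> : g (f (q s)) = d (h (q s)) + h (d (q s)) + q s by rewrite -htpy subrK.
rewrite /E raddfB raddfD; set x := d _; set y := h (d _); set t := h (blocks _ _ _).
set u := h (D _ _); apply: (addIr (y + t)); rewrite opprB -[RHS]addrA subrK.
by rewrite [LHS](AC (1*(1*2)*2) (2*5*3*6*4*1)).
Qed.

Lemma coder_odd_b s : s != [::] ->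
  blocks (tau \o chi) b s = - tau (blocks chi b s).
Proof.
move=> s0; rewrite blocks_comp.
rewrite (@eq_blocksr _ _ _ _ _ ((-%R \o tau) \o b)) => [|//|w w0] /=.
  by rewrite blocks_additive // => x y; rewrite /= raddfD opprD.
rewrite /b b'_tau // raddfD opprD; congr (_ + _).
by case: (w) => [|x [|y t]] /=; rewrite ?d_tau ?raddf0 ?oppr0.
Qed.

Lemma q_identity s : s != [::] -> E s = 0.
Proof.
have [n] := ubnP (size s); elim: n s => // n IHn s sn s0.
have b_add : multiadd b.
  by move=> u v x y; rewrite /b b'_add (multiadd_unary1 (raddfD d)) addrACA.
have tau_add : multiadd (unary1 tau) by apply: multiadd_unary1; apply: raddfD.
have tchi_add : multiadd (tau \o chi) by move=> u v x y /=; rewrite chi_add raddfD.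
have K_add : multiadd K by move=> u v x y; rewrite /K /= q_add raddfD.
have IH a : a != [::] -> (size a < size s)%N -> E a = 0.
  by move=> a0 as_; apply: IHn => //; apply: leq_trans as_ _.
pose C (M : zmodType) := @coder V V M (tau \o chi) K id1.
(* The prefix map is [tau] after [tau \o chi], that is [chi]. In the last summand, [K] preceded by
   [tau] gives [- tau (K a)], as [h] is odd and [q] even. *)
have DC : D (C _ b') s = coder chi (D K) id1 b' s
    + coder2 chi (tau \o D chi) (tau \o chi) K id1 b' s
    + coder2 chi (fun a => - tau (K a)) (unary1 tau) b id1 b' s.
  rewrite /D /C coder_coder //; congr (_ + _ + _).
  - apply: eq_coder => a a0 _; split=> //.
      by rewrite unary1_blocks //= chi_tau // tauK.
    by rewrite unary1_blocks // map_id.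
  - apply: eq_coder2 => a a0; rewrite !unary1_blocks // map_id /= chi_tau // tauK.
    by rewrite coder_additive //; apply: raddfD.
  - apply: eq_coder2 => a a0; rewrite !unary1_blocks // map_id /= chi_tau // tauK.
    rewrite /K /= q_tau // h_tau coder_unary1 //; split=> //.
    by case: (a) => [|x [|]].
have CD : C _ (D b') s = coder chi (C _ b) id1 b' s
    + coder2 chi (tau \o K) (unary1 tau) b id1 b' s
    + coder2 chi (fun a => - tau (blocks chi b a)) (tau \o chi) K id1 b' s.
  rewrite /D /C coder_coder //; congr (_ + _ + _).
  - apply: eq_coder => a a0 _; split=> //.
      by rewrite blocks_unary1 //= tauK.
    by rewrite unary1_blocks // map_id.
  - apply: eq_coder2 => a a0; rewrite !unary1_blocks // map_id /=.
    by rewrite blocks_unary1 //= tauK coder_unary1.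
  - apply: eq_coder2 => a a0; rewrite !unary1_blocks // map_id /=.
    by rewrite !blocks_unary1 //= tauK coder_unary1 // coder_odd_b.
have comm : D (C _ b') s + C _ (D b') s
    = blocks chi b' s - b' s - coder chi (h \o E) id1 b' s.
  rewrite DC CD; set c1 := coder chi (D K) _ _ _; set c2 := coder chi (C _ b) _ _ _.
  set e1 := coder2 chi (tau \o D chi) _ _ _ _ _; set e2 := coder2 _ _ (unary1 tau) _ _ _ _.
  set e3 := coder2 chi (tau \o K) _ _ _ _ _; set e4 := coder2 _ _ _ _ _ _ _.
  (* These two terms add up to the defect of [chi] in the first marked block, which is proper
     because the block of [K] comes after it. *)
  have e14 : e1 + e4 = 0.
    rewrite -coder2D //; apply: coder2_eq0_lt => // a a0 as_ /=.
    rewrite chi_morphism_at ?addrN // => a' a'0 a's; apply: IH => //.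
    exact: leq_ltn_trans as_.
  have e23 : e2 + e3 = 0.
    by rewrite -coder2D //; apply: coder2_eq0_lt => // a a0 as_; rewrite addNr.
  (* The sum of the marked components is [chi - 1 - h E] by [homotopy_at], and the coderivation
     marked by [chi - 1] is a difference of two morphisms by [blocksB]. *)
  have c12 : c1 + c2 = blocks chi b' s - b' s - coder chi (h \o E) id1 b' s.
    rewrite -{2}(map_id s) -unary1_blocks // blocksB // -coderB // -coderD //.
    by apply: eq_coderE => a a0 _; rewrite homotopy_at.
  by rewrite [LHS](AC (3*3) ((1*4)*(2*6)*(3*5))) /= e14 e23 !addr0.
have hE : coder chi (h \o E) id1 b' s = 0.
  by apply: coder_eq0_lt => // a a0 as_ /=; rewrite IH ?raddf0.
rewrite {}hE subr0 in comm.
have C_Db' : C _ (D b') s = - d (C _ b' s).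
  rewrite /C (eq_coderr _ _ _ s0 D_b').
  rewrite (@coder_additive _ _ _ _ (-%R \o d)) // => x y.
  by rewrite /= raddfD opprD.
rewrite /E /D (eq_coderr _ _ _ s0 qE) coder_add coder_unary1 // -/(D (C _ b') s).
rewrite {1}qE // raddfD -/(C _ b' s).
have -> : D (C _ b') s = blocks chi b' s - b' s + d (C _ b' s).
  by rewrite -comm C_Db' subrK.
rewrite unary1_comp /b; apply/eqP; rewrite subr_eq0; apply/eqP.
by rewrite [RHS](AC (2*(2*1)) (((1*5)*3)*(2*4))) /= subrr addr0.
Qed.

Lemma chi_morphism s : s != [::] -> blocks chi b s = D chi s.
Proof. by move=> s0; apply: chi_morphism_at => // a a0 _; apply: q_identity. Qed.

Lemma phi_morphism s : s != [::] -> blocks phi bW s = D phi s.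
Proof. by move=> s0; apply: phi_morphism_at => //; apply: q_identity. Qed.

Lemma q_relation s : s != [::] -> d (q s) + blocks (g \o f \o q) p s = D q s.
Proof.
by move=> s0; have /eqP := q_identity s0; rewrite blocks_p // subr_eq0 => /eqP.
Qed.

Lemma homotopy s : s != [::] ->
  D K s + coder (tau \o chi) K id1 b s = chi s - id1 s.
Proof. by move=> s0; rewrite homotopy_at // q_identity // raddf0 subr0. Qed.

Lemma suspended_transfer :
  (forall s : seq W, s != [::] -> DW bW s = 0 /\ blocks Psi b s = DW Psi s) /\
  (forall s : seq V, s != [::] ->
    [/\ d (q s) + blocks (g \o f \o q) p s = D q s,
        blocks phi bW s = D phi s, blocks chi b s = D chi s &
        D K s + coder (tau \o chi) K id1 b s = chi s - id1 s]).
Proof.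
split=> s s0; first by split; [apply: nu_Ainf | apply: Psi_morphism].
by split; [apply: q_relation | apply: phi_morphism | apply: chi_morphism
  | apply: homotopy].
Qed.

End SuspendedTransfer.

(** * The Koszul involution and suspension *)

Lemma sign_parity (R : pzRingType) m n : odd m = odd n -> (-1) ^+ m = (-1) ^+ n :> R.
Proof. by rewrite -signr_odd => ->; rewrite signr_odd. Qed.

Section Koszul.
Variables (R : comPzRingType) (V : gradedModule R).
Implicit Types (x y : V) (b i : int).

Lemma homog_proj i x : homog i (gm_proj V i x).
Proof. by rewrite /homog gm_projK eqxx. Qed.

Lemma fsbig_supp (M : nmodType) (F : int -> M) (r : seq int) : uniq r ->
  (forall i, F i != 0 -> i \in r) ->
  \sum_(i \in [set: int]%classic) F i = \sum_(i <- r) F i.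
Proof.
move=> r_uniq Fr; rewrite [RHS]fsbig_seq //; symmetry; apply: fsbig_widen => // i [_ /= ir].
by apply/eqP; apply: contra_notT ir => /Fr.
Qed.

Lemma gm_supp x : exists2 r : seq int,
  uniq r & forall i, gm_proj V i x != 0 -> i \in r.
Proof.
have /finite_seqP[r rE] := gm_fin x; exists (undup r); first exact: undup_uniq.
by move=> i ix; rewrite mem_undup; have : [set` r]%classic i by rewrite -rE.
Qed.

Lemma koszul_sum b x r : uniq r -> (forall i, gm_proj V i x != 0 -> i \in r) ->
  koszul b x = \sum_(i <- r) (-1) ^+ absz (i * b) *: gm_proj V i x.
Proof.
move=> r_uniq rx; apply: fsbig_supp => // i h; apply: rx.
by apply: contraNneq h => ->; rewrite scaler0.
Qed.

Lemma proj_sum x r : uniq r -> (forall i, gm_proj V i x != 0 -> i \in r) ->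
  x = \sum_(i <- r) gm_proj V i x.
Proof. by move=> r_uniq rx; rewrite -{1}(gm_sum x); apply: fsbig_supp. Qed.

Lemma homog_sum x : exists r : seq V,
  x = \sum_(y <- r) y /\ forall y, y \in r -> exists i, homog i y.
Proof.
have [r r_uniq rx] := gm_supp x; exists [seq gm_proj V i x | i <- r].
split; first by rewrite big_map; apply: proj_sum.
by move=> _ /mapP[i _ ->]; exists i; apply: homog_proj.
Qed.

Lemma koszul_is_linear b : linear (@koszul R V b).
Proof.
move=> a x y; have [r r_uniq rx] := gm_supp x; have [r' r'_uniq ry] := gm_supp y.
have [r'' r''_uniq rxy] := gm_supp (a *: x + y).
have r0_uniq := undup_uniq (r ++ r' ++ r''); set r0 := undup _ in r0_uniq.
have in_r0 i : [|| i \in r, i \in r' | i \in r''] -> i \in r0.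
  by rewrite mem_undup !mem_cat.
rewrite !(koszul_sum _ r0_uniq) => [|i /ry ir|i /rx ir|i /rxy ir];
  try by apply: in_r0; rewrite ir ?orbT.
rewrite scaler_sumr -big_split; apply: eq_bigr => i _ /=.
by rewrite linearP scalerDr !scalerA mulrC.
Qed.

HB.instance Definition _ b :=
  GRing.isLinear.Build R V V *:%R (@koszul R V b) (koszul_is_linear b).

Lemma linear_homog_eq (U : lmodType R) (F G : {linear V -> U}) :
  (forall i x, homog i x -> F x = G x) -> F =1 G.
Proof.
move=> FG x; have [r [-> rh]] := homog_sum x; rewrite !linear_sum.
by apply: eq_big_seq => y /rh[i /FG].
Qed.

Lemma koszul_parity b b' : odd `|b| = odd `|b'| -> @koszul R V b =1 koszul b'.
Proof.
move=> bb'; apply: (linear_homog_eq (F := koszul b) (G := koszul b')) => i x ix /=.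
by rewrite !(koszul_homog _ ix) (sign_parity _ (n := `|i * b'|)) // !abszM !oddM bb'.
Qed.

Lemma koszul_even b x : ~~ odd `|b| -> koszul b x = x.
Proof.
move=> /negPf b0; have [r r_uniq rx] := gm_supp x.
rewrite (koszul_sum _ r_uniq) // [RHS](proj_sum r_uniq) //.
by apply: eq_bigr => i _; rewrite -signr_odd abszM oddM b0 andbF scale1r.
Qed.

Lemma koszulD a b x : koszul a (koszul b x) = koszul (a + b) x.
Proof.
apply: (linear_homog_eq (F := koszul a \o koszul b) (G := koszul (a + b))).
move=> i y iy /=; rewrite !(koszul_homog _ iy) linearZ /= (koszul_homog _ iy).
rewrite scalerA -exprD; congr (_ *: _); apply: sign_parity.
lia.
Qed.

Lemma koszulK b : involutive (@koszul R V b).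
Proof. by move=> x; rewrite koszulD koszul_even //; lia. Qed.

Lemma homogD i x y : homog i x -> homog i y -> homog i (x + y).
Proof. by rewrite /homog linearD => -> ->. Qed.

Lemma homogZ i a x : homog i x -> homog i (a *: x).
Proof. by rewrite /homog linearZ /= => ->. Qed.

Lemma homog0 i : homog i (0 : V).
Proof. by rewrite /homog linear0. Qed.

Lemma homog_koszul i b x : homog i x -> homog i (koszul b x).
Proof. by move=> ix; rewrite (koszul_homog _ ix); apply: homogZ. Qed.

End Koszul.

(** * Multilinear maps and reduction to homogeneous arguments *)

Section Multilinear.
Variables (R : comPzRingType) (V W : gradedModule R).
Implicit Types (F G : seq V -> W) (s t : seq V).

Lemma multilinearD n F : multilinear n F -> forall s t x y, (size s + size t).+1 = n ->
  F (s ++ (x + y) :: t) = F (s ++ x :: t) + F (s ++ y :: t).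
Proof. by move=> Fn s t x y st; have := Fn s t 1 x y st; rewrite !scale1r. Qed.

Lemma multilinear0 n F : multilinear n F -> forall s t, (size s + size t).+1 = n ->
  F (s ++ 0 :: t) = 0.
Proof.
move=> Fn s t st; apply: (addrI (F (s ++ 0 :: t))).
by rewrite -(multilinearD Fn) // !addr0.
Qed.

Lemma multilinearZ n F : multilinear n F -> forall s t a x, (size s + size t).+1 = n ->
  F (s ++ (a *: x) :: t) = a *: F (s ++ x :: t).
Proof.
by move=> Fn s t a x st; rewrite -[a *: x]addr0 Fn // (multilinear0 Fn) // addr0.
Qed.

Lemma multilinear_sum n F : multilinear n F -> forall s t r,
  (size s + size t).+1 = n ->
  F (s ++ (\sum_(y <- r) y) :: t) = \sum_(y <- r) F (s ++ y :: t).
Proof.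
move=> Fn s t r st; elim: r => [|y r IHr]; first by rewrite !big_nil (multilinear0 Fn).
by rewrite !big_cons (multilinearD Fn) // IHr.
Qed.

Definition all_homog s := forall x, x \in s -> exists i, homog i x.

Lemma multilinear_homog_eq n F G s : multilinear n F -> multilinear n G ->
  (forall t, size t = n -> all_homog t -> F t = G t) -> size s = n -> F s = G s.
Proof.
(* The induction carries a prefix [t] of letters already homogeneous; the next letter is expanded
   into its components. *)
move=> Fn Gn FG; rewrite -[s]cat0s; have : all_homog [::] by [].
elim: s [::] => [|x s IHs] t th ts; first by rewrite FG // cats0.
have [r [-> rh]] := homog_sum x; have sz : (size t + size s).+1 = n.
  by move: ts; rewrite size_cat addnS.
rewrite (multilinear_sum Fn) // (multilinear_sum Gn) //.
apply: eq_big_seq => y /rh yh; rewrite -!cat_rcons IHs //.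
  by move=> z; rewrite mem_rcons inE => /predU1P[->|/th].
by rewrite cat_rcons -ts !size_cat.
Qed.

Lemma all_homogP s : all_homog s -> exists2 e : seq int,
  size e = size s & forall j, (j < size s)%N -> homog (nth 0 e j) (nth 0 s j).
Proof.
elim: s => [|x s IHs] sh; first by exists [::].
have [i xi] := sh x (mem_head _ _).
have [|e es eh] := IHs; first by move=> y ys; apply: sh; rewrite inE ys orbT.
by exists (i :: e); rewrite /= ?es // => -[|j] //= /eh.
Qed.

Lemma multilinear_koszul n F b e s t : multilinear n F ->
  size e = size t -> (forall j, (j < size t)%N -> homog (nth 0 e j) (nth 0 t j)) ->
  (size s + size t)%N = n ->
  F (s ++ map (koszul b) t)
  = (-1) ^+ absz ((\sum_(i <- e) i) * b) *: F (s ++ t).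
Proof.
move=> Fn; elim: t e s => [|x t IHt] [|i e] s //=.
  by rewrite big_nil mul0r scale1r.
move=> [et] eh st; have xi : homog i x := eh 0%N isT.
rewrite (koszul_homog _ xi) (multilinearZ Fn); last first.
  by rewrite size_map -st addnS.
rewrite -[s ++ x :: map _ _]cat_rcons (IHt e) //; last 2 first.
- by move=> j; apply: (eh j.+1).
- by rewrite size_rcons -st addnS.
rewrite scalerA -exprD cat_rcons big_cons; congr (_ *: _); apply: sign_parity.
by move: (\sum_(j <- e) j) => k; lia.
Qed.

(** The sign computations use the degree of a map in this form only, which makes sense for arguments
    that are not homogeneous. *)
Lemma graded_map_koszul n d F b s : graded_map n d F -> size s = n ->
  F (map (koszul b) s) = (-1) ^+ absz (d * b) *: koszul b (F s).
Proof.
move=> [Fn Fd]; apply: (@multilinear_homog_eq n (fun s => F (map (koszul b) s))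
    (fun s => (-1) ^+ absz (d * b) *: koszul b (F s))) => //.
- move=> s1 s2 a x y st; rewrite !map_cat /= linearP.
  by rewrite Fn ?size_map.
- by move=> s1 s2 a x y st; rewrite Fn // linearP scalerDr !scalerA mulrC.
move=> t tn /all_homogP[e et eh]; rewrite (multilinear_koszul b Fn (s := [::]) et) //.
rewrite (koszul_homog _ (Fd e t _ tn _)) -?tn // scalerA -exprD.
congr (_ *: _); apply: sign_parity.
by move: (\sum_(j <- e) j) => k; lia.
Qed.

End Multilinear.

(** * Suspension of maps and its signs *)

Section Suspension.
Variable R : comPzRingType.

(* The Koszul sign of [s^{-1} \otimes ... \otimes s^{-1}] on the arguments. *)
Fixpoint twist (V : gradedModule R) (s : seq V) : seq V :=
  if s is x :: t then koszul (size t)%:Z x :: twist t else [::].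

(* The conjugate of [F] by the suspension. *)
Definition susp (V W : gradedModule R) (F : nat -> seq V -> W) (s : seq V) : W :=
  (-1) ^+ 'C(size s, 2) *: F (size s) (twist s).

(* The grading involution of the suspension, whose degrees are shifted by 1. *)
Definition odd_inv (V : gradedModule R) (x : V) : V := - koszul 1 x.

Lemma size_twist (V : gradedModule R) (s : seq V) : size (twist s) = size s.
Proof. by elim: s => //= x s ->. Qed.

Lemma twist_map (V W : gradedModule R) (phi : V -> W) (s : seq V) :
  (forall b x, phi (koszul b x) = koszul b (phi x)) ->
  twist (map phi s) = map phi (twist s).
Proof. by move=> phiK; elim: s => //= x s ->; rewrite phiK size_map. Qed.

Lemma twist_koszul (V : gradedModule R) b (s : seq V) :
  twist (map (koszul b) s) = map (koszul b) (twist s).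
Proof. by apply: twist_map => b' x; rewrite !koszulD addrC. Qed.

Lemma twist_cat (V : gradedModule R) (s t : seq V) :
  twist (s ++ t) = map (koszul (size t)%:Z) (twist s) ++ twist t.
Proof.
elim: s => //= x s ->; rewrite size_cat koszulD; congr (koszul _ _ :: _).
by rewrite addnC PoszD.
Qed.

(** Hence every word is a twist, and identities between suspended maps give identities on all
    words. *)
Lemma twistK (V : gradedModule R) : involutive (@twist V).
Proof. by elim=> //= x s IHs; rewrite size_twist koszulK IHs. Qed.

Lemma multiadd_susp (V W : gradedModule R) (F : nat -> seq V -> W) :
  (forall n, (0 < n)%N -> multilinear n (F n)) -> multiadd (susp F).
Proof.
move=> Flin s t x y; have sz z : size (s ++ z :: t) = (size s + size t).+1.
  by rewrite size_cat addnS.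
rewrite /susp !sz -scalerDr !twist_cat /= linearD; congr (_ *: _).
by rewrite (multilinearD (Flin _ _)) // size_map !size_twist.
Qed.

(** The minus signs of [odd_inv] on the arguments give [(-1)^n] and the Koszul signs [(-1)^(n+c)],
    so the arity drops out. Thus [c = -2] (structure maps) is odd and [c = -1] (morphisms) is
    even. *)
Lemma susp_odd_inv (V W : gradedModule R) (F : nat -> seq V -> W) c s :
  graded_map (size s) ((size s)%:Z + c) (F (size s)) ->
  susp F (map (@odd_inv V) s) = (-1) ^+ absz (c + 1) *: odd_inv (susp F s).
Proof.
move=> Fgr; have Flin := Fgr.1; rewrite /susp /odd_inv size_map.
have -> : map (fun x : V => - koszul 1 x) s = map -%R (map (koszul 1) s).
  by rewrite -map_comp.
rewrite (twist_map (phi := -%R)) => [|b x]; last by rewrite linearN.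
have negs n G (t : seq V) : multilinear n G -> size t = n ->
    G (map -%R t) = (-1) ^+ n *: G t :> W.
  elim: t n G => [|x t IHt] [|n] G //= Gn; first by rewrite scale1r.
  move=> [tn]; rewrite (IHt n (fun t => G (- x :: t))) //; last first.
    by move=> s1 s2 a y z st; apply: (Gn (- x :: s1)); rewrite /= addSn st.
  rewrite -scaleN1r (multilinearZ Gn (s := [::])) /= ?tn //.
  by rewrite scalerA exprSr.
rewrite (negs _ _ _ Flin) ?size_twist ?size_map // twist_koszul.
rewrite (graded_map_koszul _ Fgr) ?size_twist //.
rewrite [X in _ = _ *: - X]linearZ /= -scaleN1r !scalerA.
congr (_ *: _); rewrite mulrN1 mulNr -[- (_ * _)]mulN1r -!exprD -exprS; apply: sign_parity.
lia.
Qed.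

(** Modulo 2, [j.+1] is the degree [j - 1] of the first factor, which is multiplied by the number of
    later blocks; ['C(j, 2)] comes from replacing the factor by its suspension. *)
Fixpoint blocks_sign (r : seq nat) : nat :=
  if r is j :: u then blocks_sign u + j.+1 * size u + 'C(j, 2) else 0.

(** The marked factor has arity [l] and degree [l] modulo 2, and [c] identities follow it. The
    summand 1 is the minus sign of [odd_inv], applied to each block before the mark. *)
Fixpoint coder_sign (u : seq nat) (l c : nat) : nat :=
  if u is j :: u' then coder_sign u' l c + j.+1 * (size u' + c) + 1 + 'C(j, 2)
  else l * c + 'C(l, 2).

Lemma vartheta_cons j u :
  vartheta (j :: u) = (vartheta u + j * (sumn u + size u))%N.
Proof.
rewrite /vartheta big_ord_recl big_ord0 add0n.
under eq_bigr => i _ do rewrite big_ord_recl /=.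
rewrite big_split /= addnC; congr (_ + _)%N; rewrite -big_distrr /=; congr muln.
under eq_bigr do rewrite -addn1.
by rewrite big_split /= sum_nat_const card_ord muln1 sumnE (big_nth 0%N) big_mkord.
Qed.

Lemma bin2D m n : 'C(m + n, 2) = ('C(m, 2) + 'C(n, 2) + m * n)%N.
Proof.
elim: m => [|m IHm]; first by rewrite add0n bin0n mul0n addn0.
by rewrite addSn !binS !bin1 IHm mulSn; move: 'C(m, 2) 'C(n, 2) (m * n)%N; lia.
Qed.

(* [vartheta] is the sign that makes the suspended sum over B(n) sign-free. *)
Lemma odd_blocks_sign r :
  odd ('C(sumn r, 2) + vartheta r + blocks_sign r) = odd 'C(size r, 2).
Proof.
elim: r => [|j u IHu]; first by rewrite /vartheta big_ord0.
rewrite /= vartheta_cons bin2D binS bin1; move: IHu.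
set a := 'C(sumn u, 2); set b := vartheta u; set c := blocks_sign u.
set e := 'C(size u, 2); move: a b c e => a b c e.
move: 'C(j, 2) (sumn u) (size u) => v m k.
rewrite !oddD !oddM !oddD /=.
by case: (odd a) (odd b) (odd c) (odd e) (odd v) (odd m) (odd k) (odd j)
  => [] [] [] [] [] [] [] [].
Qed.

Lemma coder_sign_cons j u l c : coder_sign (j :: u) l c
  = (coder_sign u l c + j.+1 * (size u + c) + 1 + 'C(j, 2))%N.
Proof. by []. Qed.

(** The analogue of [odd_blocks_sign] for the exponent [n + r_i + vartheta] of the sum over C(n),
    with [r = rcons u l] and [n = sumn u + l + c]. *)
Lemma odd_coder_sign u l c :
  odd ('C(sumn u + l + c, 2) + (sumn u + l + c + l + vartheta (rcons u l))
       + coder_sign u l c)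
  = odd 'C(size u + c.+1, 2).
Proof.
elim: u => [|j u].
  rewrite vartheta_cons /= /vartheta big_ord0 bin2D.
  rewrite !add0n muln0 binS bin1 !oddD !oddM /=.
  by case: (odd 'C(l, 2)) (odd 'C(c, 2)) (odd l) (odd c) => [] [] [] [].
have -> : sumn (j :: u) = (j + sumn u)%N by [].
have -> : size (j :: u) = (size u).+1 by [].
rewrite rcons_cons vartheta_cons coder_sign_cons addSn binS bin1.
rewrite sumn_rcons size_rcons -!addnA (bin2D j).
set a := 'C(sumn u + _, 2); set b := vartheta _; set d := coder_sign _ _ _.
set e := 'C(_ + c.+1, 2); move: a b d e => a b d e.
move: 'C(j, 2) (sumn u) (size u) => v m k.
rewrite !oddD !oddM !oddD /=.
by case: (odd a) (odd b) (odd d) (odd e) (odd v) (odd m) (odd k) (odd j)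
  (odd l) (odd c) => [] [] [] [] [] [] [] [] [] [].
Qed.

End Suspension.

(** * Tensor products of maps on twisted words *)

Section TensorTwist.
Variable R : comPzRingType.

Lemma multilinear_cons (V W : gradedModule R) n (G : seq V -> W) x :
  multilinear n.+1 G -> multilinear n (fun s => G (x :: s)).
Proof.
by move=> Gn s t a y z st; apply: (Gn (x :: s)); rewrite /= addSn st.
Qed.

Lemma graded_map_koszulM (V W : gradedModule R) n d (F : seq V -> W) (a b : int) (k : nat) s :
  graded_map n d F -> size s = n -> odd (absz (a + b)) = odd k ->
  F (map (koszul a) (map (koszul b) s))
  = (-1) ^+ (absz d * k) *: koszul k (F s).
Proof.
move=> Fn sn abk; rewrite -map_comp (eq_map (koszulD a b)).
rewrite (graded_map_koszul _ Fn sn).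
rewrite (koszul_parity (b' := k)) //; congr (_ *: _); apply: sign_parity.
by rewrite abszM !oddM abk.
Qed.

Lemma susp_twist (V W : gradedModule R) (F : nat -> seq V -> W) s :
  F (size s) (twist s) = (-1) ^+ 'C(size s, 2) *: susp F s.
Proof. by rewrite scalerA -exprD addnn -signr_odd odd_double scale1r. Qed.

Variables (U V W : gradedModule R).

Lemma sum_deg_blocks (F : nat -> seq U -> V) r :
  \sum_(f <- [seq TFactor j (j%:Z - 1) (F j) | j <- r]) tf_deg f
  = (sumn r)%:Z - (size r)%:Z.
Proof. by elim: r => [|j r IHr]; rewrite ?big_nil //= big_cons IHr /=; lia. Qed.

Lemma twist_take_drop n (s : seq V) : (n <= size s)%N ->
  take n (twist s) = map (koszul (size s - n)%N) (twist (take n s))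
  /\ drop n (twist s) = twist (drop n s).
Proof.
move=> ns; rewrite -{1 4}(cat_take_drop n s) twist_cat size_drop.
by rewrite take_size_cat ?drop_size_cat ?size_map ?size_twist ?size_takel.
Qed.

End TensorTwist.

Section TensorBlocks.
Variables (R : comPzRingType) (U V W : gradedModule R).

Lemma size_tensor (fs : seq (tfactor U V)) s : size (tensor fs s) = size fs.
Proof. by elim: fs s => //= f fs IHfs s; rewrite IHfs. Qed.

Lemma tensor_blocks (F : nat -> seq U -> V) (G : seq V -> W) r s :
  (forall j, j \in r -> graded_map j (j%:Z - 1) (F j)) ->
  multilinear (size r) G -> sumn r = size s ->
  G (tensor [seq TFactor j (j%:Z - 1) (F j) | j <- r] (twist s))
  = (-1) ^+ blocks_sign r *: G (twist (map (susp F) (reshape r s))).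
Proof.
elim: r G s => [|j r IHr] G s Fr Gr /= rs; first by rewrite scale1r.
have js : (j <= size s)%N by rewrite -rs leq_addr.
have s2 : size (drop j s) = sumn r by rewrite size_drop -rs addKn.
have [-> ->] := twist_take_drop js; rewrite sum_deg_blocks.
(* The later factors contribute [sumn r - size r] and the twist by the later letters [sumn r]:
   modulo 2 this is [size r], exactly the twist of the first letter in the word of blocks. *)
rewrite (@graded_map_koszulM _ _ _ _ _ _ _ _ (size r) _ (Fr j (mem_head _ _)));
  last 2 first.
- by rewrite size_twist size_takel.
- by rewrite -rs addKn; move: (sumn r) (size r) => a b; clear; lia.
have sj : size (take j s) = j by rewrite size_takel.
have := susp_twist F (take j s); rewrite sj => ->.
rewrite linearZ /= !scalerA (multilinearZ Gr (s := [::])) /=; last first.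
  by rewrite size_tensor size_map.
rewrite (IHr (fun w => G (_ :: w))) //; last 2 first.
- by move=> i ir; apply: Fr; rewrite inE ir orbT.
- exact: multilinear_cons.
rewrite scalerA size_map size_reshape -!exprD; congr (_ *: _).
have oj : odd (absz (j%:Z - 1)) = ~~ odd j by clear; lia.
apply: sign_parity; rewrite !oddD !oddM oj /=.
by case: (odd j) (odd (size r)) (odd 'C(j, 2)) (odd (blocks_sign r))
  => [] [] [] [].
Qed.

End TensorBlocks.

Section TensorCoder.
Variables (R : comPzRingType) (V W : gradedModule R).

Lemma sum_deg_idf c : \sum_(f <- nseq c (idf V)) tf_deg f = 0.
Proof. by elim: c => [|c IHc]; rewrite ?big_nil //= big_cons IHc. Qed.

Lemma tensor_idf c (s : seq V) : size s = c -> tensor (nseq c (idf V)) s = s.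
Proof.
elim: c s => [|c IHc] [|x s] //= [sc]; rewrite sum_deg_idf take0 drop0 IHc //.
by rewrite /unary /= koszul_even.
Qed.

(** The marked map only needs a degree with the parity of its arity. This covers a homotopy
    component of degree [l], a structure map of degree [l - 2], and the differential with [l = 1]
    and degree -1. *)
Lemma tensor_coder (F : nat -> seq V -> V) (H : seq V -> V) l dl
    (G : seq V -> W) u c s :
  (forall j, j \in u -> graded_map j (j%:Z - 1) (F j)) ->
  graded_map l dl H -> odd (absz dl) = odd l ->
  multilinear (size u + c.+1) G -> (sumn u + l + c)%N = size s ->
  G (tensor ([seq TFactor j (j%:Z - 1) (F j) | j <- u]
             ++ TFactor l dl H :: nseq c (idf V)) (twist s))
  = (-1) ^+ coder_sign u l c
    *: G (twist (map (@odd_inv _ V \o susp F) (reshape u s)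
                 ++ ((-1) ^+ 'C(l, 2) *: H (twist (take l (drop (sumn u) s))))
                 :: drop (sumn u + l) s)).
Proof.
move=> + Hl dl_odd; elim: u G s => [|j u IHu] G s Fu Gu /=.
  rewrite add0n drop0 => rs; have ls : (l <= size s)%N by rewrite -rs leq_addr.
  have [-> ->] := twist_take_drop ls; rewrite sum_deg_idf.
  rewrite tensor_idf ?size_twist ?size_drop -?rs ?addKn //.
  rewrite (@graded_map_koszulM _ _ _ _ _ _ _ _ c _ Hl) ?size_twist ?size_takel //.
  rewrite linearZ /= (multilinearZ Gu (s := [::])); last first.
    by rewrite size_twist size_drop -rs addKn.
  rewrite (multilinearZ Gu (s := [::])); last first.
    by rewrite size_twist size_drop -rs addKn.
  rewrite scalerA -exprD; congr (_ *: _); apply: sign_parity.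
  by rewrite -addnA addnn !oddD !oddM odd_double addbF dl_odd.
rewrite -addnA -addnA addnA => rs.
have js : (j <= size s)%N by rewrite -rs -addnA leq_addr.
have [-> ->] := twist_take_drop js.
rewrite big_cat big_cons sum_deg_idf sum_deg_blocks /=.
rewrite (@graded_map_koszulM _ _ _ _ _ _ _ _ (size u + c) _ (Fu j (mem_head _ _)));
  last 2 first.
- by rewrite size_twist size_takel.
- rewrite -rs -!addnA addKn; move: dl_odd.
  by move: (sumn u) (size u) => a b; clear; lia.
have sj : size (take j s) = j by rewrite size_takel.
have := susp_twist F (take j s); rewrite sj => ->.
rewrite linearZ /= !scalerA (multilinearZ Gu (s := [::])) /=; last first.
  by rewrite size_tensor size_cat size_map /= size_nseq.
rewrite (IHu (fun w => G (_ :: w))) //; last 3 first.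
- by move=> i iu; apply: Fu; rewrite inE iu orbT.
- exact: multilinear_cons.
- by rewrite size_drop -rs -!addnA addKn.
rewrite !drop_drop size_cat /= size_map size_reshape size_drop -rs.
have -> : (j + sumn u + (l + c) - (j + sumn u + l)).+1 = c.+1 by clear; lia.
rewrite [(j + sumn u)%N]addnC addnAC; set y := susp F (take j s).
(* Since the marked factor has degree [l] and not [l - 1], the accumulated exponent is one less than
   the twist of the first letter; the missing [koszul 1] is [odd_inv] up to sign. *)
have -> : koszul (size u + c.+1)%N (odd_inv y) = (-1) *: koszul (size u + c)%N y.
  rewrite /odd_inv [LHS]linearN /= koszulD scaleN1r; congr (- _); apply: koszul_parity.
  by clear; lia.
rewrite (multilinearZ Gu (s := [::])) /=; last first.
  rewrite size_twist size_cat size_map size_reshape /= size_drop -rs.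
  by clear; lia.
rewrite !scalerA -[in RHS]exprSr -!exprD; congr (_ *: _).
have oj : odd (absz (j%:Z - 1)) = ~~ odd j by clear; lia.
apply: sign_parity; rewrite /= !oddD !oddM oj !oddD /=.
by case: (odd j) (odd (size u)) (odd 'C(j, 2)) (odd (coder_sign u l c)) (odd c)
  => [] [] [] [] [].
Qed.

End TensorCoder.

(** * Suspension of the sums over A(n), B(n), C(n) *)

Section Compositions.

(* The compositions of [n] into [k] positive parts. *)
Fixpoint wcomp k n : seq (seq nat) :=
  if k is k'.+1 then [seq j :: r | j <- iota 1 n, r <- wcomp k' (n - j)%N]
  else if n == 0%N then [:: [::]] else [::].

Lemma big_wcompS (M : nmodType) k n (F : seq nat -> M) :
  \sum_(r <- wcomp k.+1 n) F r
  = \sum_(j <- iota 1 n) \sum_(r <- wcomp k (n - j)%N) F (j :: r).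
Proof. exact: big_allpairs_dep. Qed.

Lemma mem_wcomp k n r : r \in wcomp k n ->
  [/\ size r = k, sumn r = n & all (fun j => 0 < j)%N r].
Proof.
elim: k n r => [|k IHk] n r /=; first by case: eqP => // ->; rewrite inE => /eqP->.
case/allpairsPdep=> j [u [+ /IHk[su nu pu] ->]]; rewrite mem_iota => /andP[j0 jn].
by rewrite /= su nu pu j0 subnKC //; lia.
Qed.

(** The parts of a composition of [m] are at most [m < N], so bounding them by ['I_N] loses nothing.
    Compositions built from their first part match the recursion of [blocks]. *)
Lemma big_tuple_wcomp (M : nmodType) N k m (F : seq nat -> M) : (m < N)%N ->
  \sum_(r : k.-tuple 'I_N | all (fun j => 0 < j)%N (map val r)
                            && (sumn (map val r) == m)) F (map val r)
  = \sum_(r <- wcomp k m) F r.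
Proof.
elim: k m F => [|k IHk] m F mN.
  rewrite big_mkcond (bigD1 [tuple]) //= big1 => [|t]; last by rewrite tuple0.
  by rewrite addr0 eq_sym; case: eqP; rewrite ?big_seq1 ?big_nil.
rewrite big_wcompS big_mkcond.
rewrite (reindex (fun p : 'I_N * k.-tuple 'I_N => cons_tuple p.1 p.2)); last first.
  exists (fun t => (thead t, behead_tuple t)) => [[j r] _|t _] /=.
    by congr (_, _); apply: val_inj.
  by rewrite [RHS](tuple_eta t).
rewrite -(pair_big xpredT xpredT (fun j (r : k.-tuple 'I_N) =>
  if all (fun i => 0 < i)%N (map val (cons_tuple j r))
     && (sumn (map val (cons_tuple j r)) == m)
  then F (map val (cons_tuple j r)) else 0)) /=.
transitivity (\sum_(j < N) if (0 < j <= m)%N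
    then \sum_(r <- wcomp k (m - j)%N) F (val j :: r) else 0).
  apply: eq_bigr => j _; case: ifP => [/andP[j0 jm]|jm].
    rewrite -IHk ?(leq_ltn_trans _ mN) ?leq_subr // [RHS]big_mkcond.
    apply: eq_bigr => r _; rewrite j0 /=; congr (if _ && _ then _ else _).
    by rewrite -[in LHS](subnKC jm) eqn_add2l.
  rewrite big1 // => r _; case: ifP => // /andP[/andP[j0 _] /eqP jr].
  by rewrite j0 -jr leq_addr in jm.
rewrite -(big_mkord xpredT (fun j => if (0 < j <= m)%N
  then \sum_(r <- wcomp k (m - j)%N) F (j :: r) else 0)).
rewrite (big_cat_nat (n := m.+1)) //= [X in _ + X]big_nat [X in _ + X]big1 => [|j]; last first.
  by case/andP=> mj _; rewrite [(j <= m)%N]leqNgt mj andbF.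
rewrite addr0 big_ltn // add0r big_nat; under eq_bigr => j -> do [].
by rewrite -big_nat /index_iota subn1.
Qed.

Lemma sumB_wcomp (M : nmodType) n (F : seq nat -> M) :
  sumB n F = \sum_(2 <= k < n.+1) \sum_(r <- wcomp k n) F r.
Proof. by apply: eq_bigr => k _; rewrite big_tuple_wcomp. Qed.

Lemma sumC_wcomp (M : nmodType) n (F : nat -> nat -> seq nat -> M) :
  sumC n F = \sum_(2 <= k < n.+1) \sum_(1 <= i < k.+1)
    \sum_(r <- wcomp i (n - (k - i))%N) F k i r.
Proof.
apply: eq_big_nat => k /andP[_ kn]; apply: eq_big_nat => i _.
rewrite -(big_tuple_wcomp (N := n.+1)) ?ltnS ?leq_subr //; apply: eq_bigl => r.
by congr (_ && _); apply/eqP/eqP; lia.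
Qed.

(** The first block also contains the letter removed before cutting, hence [(size p.1).+1]. The
    guard prevents truncated subtraction from producing spurious compositions of 0 when fewer than
    [c] letters remain. *)
Lemma cuts_wcomp (T : eqType) (M : nmodType) (s : seq T) i c (F : seq nat -> M) :
  \sum_(p <- cuts s) (if (c <= size p.2)%N
    then \sum_(r <- wcomp i (size p.2 - c)%N) F ((size p.1).+1 :: r) else 0)
  = \sum_(r <- wcomp i.+1 ((size s).+1 - c)%N) F r.
Proof.
rewrite big_wcompS cutsE big_map.
have [cs|sc] := leqP c (size s).+1; last first.
  rewrite (eqP (_ : ((size s).+1 - c == 0)%N)) ?subn_eq0 1?ltnW // big_nil big_seq.
  by rewrite big1 // => m _ /=; rewrite size_drop ifF //; lia.
have -> : iota 0 (size s).+1 = iota 0 ((size s).+1 - c) ++ iota ((size s).+1 - c) c.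
  by rewrite -iotaD; congr iota; lia.
rewrite big_cat /= [X in _ + X]big_seq [X in _ + X]big1 => [|m]; last first.
  by rewrite mem_iota size_drop => ?; rewrite ifF //; lia.
rewrite addr0 (iotaDl 1 0) big_map [LHS]big_seq [RHS]big_seq.
apply: eq_bigr => m; rewrite mem_iota add0n => /= ms.
rewrite size_drop size_takel; last by lia.
by rewrite ifT; [congr (\sum_(r <- wcomp i _) _); lia | lia].
Qed.

End Compositions.

(** * Splittings sorted by the number and the sizes of blocks *)

Section SplitsBySize.
Variables (V W M : zmodType).
Implicit Types (A E F : seq V -> W) (G : seq W -> M).

Definition only k G (w : seq W) : M := if size w == k then G w else 0.

Lemma multiadd_only k G : multiadd G -> multiadd (only k G).
Proof.
move=> Gadd s t x y; rewrite /only !size_cat /=.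
by case: ifP; rewrite ?addr0.
Qed.

Lemma only_cons k G v w : only k.+1 G (v :: w) = only k (fun w => G (v :: w)) w.
Proof. by rewrite /only eqSS. Qed.

Lemma sum_only n G w : (size w <= n)%N ->
  \sum_(2 <= k < n.+1) only k G w = if (1 < size w)%N then G w else 0.
Proof.
move=> wn; under eq_bigr => k _ do rewrite /only eq_sym.
by rewrite -big_mkcond big_nat1_eq ltnS wn andbT.
Qed.

Lemma take_cuts (T : eqType) (s : seq T) p x : p \in cuts s ->
  take (size p.1).+1 (x :: s) = x :: p.1 /\ drop (size p.1).+1 (x :: s) = p.2.
Proof. by move=> /cat_cuts <-; rewrite /= take_size_cat ?drop_size_cat. Qed.

Lemma reshape_cons (T : Type) j r (s : seq T) :
  reshape (j :: r) s = take j s :: reshape r (drop j s).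
Proof. by []. Qed.

Lemma blocks_only F k G s : blocks F (only k G) s
  = \sum_(r <- wcomp k (size s)) G (map F (reshape r s)).
Proof.
elim: k G s => [|k IHk] G [|x s]; rewrite ?big_seq1 ?big_nil //.
  rewrite blocks_cons big1 // => p _; exact: wsplit_zero.
rewrite blocks_cons -[size _]subn0 -cuts_wcomp [LHS]big_seq [RHS]big_seq.
apply: eq_bigr => p ps; have [t1 t2] := take_cuts x ps; rewrite subn0.
under [RHS]eq_bigr do rewrite reshape_cons t1 t2 map_cons.
rewrite -(IHk (fun w => G (F (x :: p.1) :: w))); apply: eq_wsplitr => w.
exact: only_cons.
Qed.

Lemma blocks_trunc F G G' s :
  (forall w, w != [::] -> G' w = if (1 < size w)%N then G w else 0) -> s != [::] ->
  blocks F G' s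
  = \sum_(2 <= k < (size s).+1) \sum_(r <- wcomp k (size s)) G (map F (reshape r s)).
Proof.
move=> GG' s0; under eq_bigr do rewrite -blocks_only.
rewrite -wsplit_sum; apply: eq_wsplit => // w ws; rewrite (negPf s0) => /negbT w0.
by rewrite sum_only // GG'.
Qed.

Fixpoint coder_word A E (r : seq nat) (s : seq V) : seq W :=
  match r with
  | [::] => [::]
  | [:: l] => [:: E (take l s)]
  | j :: u => A (take j s) :: coder_word A E u (drop j s)
  end.

Lemma coder_word1 A E l s : coder_word A E [:: l] s = [:: E (take l s)].
Proof. by []. Qed.

Lemma coder_word_cons A E i j u s : coder_word A E (i :: j :: u) s
  = A (take i s) :: coder_word A E (j :: u) (drop i s).
Proof. by []. Qed.

Lemma sumn1 j : sumn [:: j] = j.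
Proof. exact: addn0. Qed.

Lemma sumn_cons j u : sumn (j :: u) = (j + sumn u)%N.
Proof. by []. Qed.

Lemma coder_word_rcons A E u l s : coder_word A E (rcons u l) s
  = map A (reshape u s) ++ [:: E (take l (drop (sumn u) s))].
Proof.
elim: u s => [|j u IHu] s /=; first by rewrite drop0.
by rewrite IHu drop_drop addnC; case: u {IHu}.
Qed.

End SplitsBySize.

Section CoderBySize.
Variables (V M : zmodType).
Implicit Types (A E : seq V -> V) (G : seq V -> M).

(** The index [i] is the position of the marked block; after it every block is a single letter, so
    exactly [k - i] letters remain. *)
Lemma coder_only A E k G s : multiadd G ->
  coder A E (unary1 id) (only k G) s
  = \sum_(1 <= i < k.+1) (if (k - i <= size s)%N
      then \sum_(r <- wcomp i (size s - (k - i))%N)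
        G (coder_word A E r s ++ drop (sumn r) s) else 0).
Proof.
elim: k G s => [|k IHk] G [|x s] Gadd.
- by rewrite coder0 big_geq.
- rewrite big_geq // coder_cons; last exact: multiadd_only.
  rewrite big1 // => p _; rewrite [X in X + _]wsplit_zero add0r.
  exact: wsplit_zero.
- rewrite coder0 big_nat big1 // => i /andP[i0 ik]; case: ifP => // _.
  by case: i i0 ik => // i _ _; rewrite big_nil.
rewrite coder_cons ?big_split; last exact: multiadd_only.
(* The term [i = 1] is the one whose first block is marked. *)
rewrite big_ltn // addrC; congr (_ + _); last first.
  rewrite subSS subn0; have [ks|sk] := leqP k (size (x :: s)); last first.
    rewrite big_seq big1 // => p /size_cuts ps.
    rewrite unary1_blocks ?map_id; last exact/multiadd_cons/multiadd_only.
    rewrite only_cons /only ltn_eqF // (leq_ltn_trans _ (ltnW sk : size s < k)%N) //.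
    by rewrite -ps leq_addl.
  rewrite -cuts_wcomp [LHS]big_seq [RHS]big_seq; apply: eq_bigr => p ps.
  rewrite unary1_blocks ?map_id; last exact/multiadd_cons/multiadd_only.
  have [t1 t2] := take_cuts x ps; rewrite only_cons /only.
  case: ltngtP => [lt|//|e].
    by rewrite (_ : wcomp 0 _ = [::]) ?big_nil //= subn_eq0 leqNgt lt.
  rewrite -e subnn -[wcomp 0 0]/[:: [::]] big_seq1 coder_word1 sumn1.
  by rewrite t1 t2.
rewrite big_add1 /=; under eq_bigr => p _.
  rewrite /coder; under eq_wsplitr do rewrite only_cons.
  rewrite [wsplit _ _ _ _ _](IHk _ _ (multiadd_cons _ Gadd)); over.
rewrite exchange_big /=; apply: eq_big_nat => i /andP[i0 ik].
rewrite subSS; have [ks|sk] := leqP (k - i) (size s).+1; last first.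
  rewrite big_seq big1 // => p /size_cuts ps; rewrite ifF // leqNgt.
  by rewrite (leq_ltn_trans _ (ltnW sk)) // -ps leq_addl.
rewrite -cuts_wcomp [LHS]big_seq [RHS]big_seq; apply: eq_bigr => p ps.
have [t1 t2] := take_cuts x ps; case: ifP => // _; rewrite [LHS]big_seq [RHS]big_seq.
apply: eq_bigr => r /mem_wcomp[ri _ _].
case: r ri i0 => [<-//|j r] _ _.
by rewrite sumn_cons addnC -drop_drop coder_word_cons t1 t2.
Qed.

Lemma coder_trunc A E G G' s : multiadd G ->
  (forall w, w != [::] -> G' w = if (1 < size w)%N then G w else 0) -> s != [::] ->
  coder A E (unary1 id) G' s
  = \sum_(2 <= k < (size s).+1) \sum_(1 <= i < k.+1)
      \sum_(r <- wcomp i (size s - (k - i))%N)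
        G (coder_word A E r s ++ drop (sumn r) s).
Proof.
move=> Gadd GG' s0.
transitivity (\sum_(2 <= k < (size s).+1) coder A E (unary1 id) (only k G) s).
  rewrite -wsplit_sum; apply: eq_wsplit => // w ws; rewrite (negPf s0) => /negbT w0.
  by rewrite sum_only // GG'.
apply: eq_big_nat => k /andP[_ ks]; rewrite coder_only //.
apply: eq_big_nat => i _; rewrite ifT // (leq_trans (leq_subr _ _)) //.
Qed.

Lemma coder_unary tau E G s : multiadd G ->
  coder (unary1 tau) E (unary1 id) G s
  = \sum_(1 <= l < (size s).+1) \sum_(0 <= a < (size s).+1 - l)
      G (map tau (take a s) ++ E (take l (drop a s)) :: drop (a + l) s).
Proof.
elim: s G => [|x s IHs] G Gadd; first by rewrite coder0 big_geq.
rewrite coder_cons // big_split /= big_cuts_first => [|p p10]; last first.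
  by case: p.1 p10 => //= a b _; apply: wsplit_head0.
rewrite (IHs (fun w => G (tau x :: w))); last exact: multiadd_cons.
have -> : \sum_(p <- cuts s) blocks (unary1 id) (fun w => G (E (x :: p.1) :: w)) p.2
    = \sum_(1 <= l < (size s).+2) G (E (take l (x :: s)) :: drop l (x :: s)).
  rewrite cutsE big_map /index_iota subn1 (iotaDl 1 0) big_map.
  apply: eq_bigr => m _; rewrite unary1_blocks ?map_id //; exact: multiadd_cons.
rewrite addrC; transitivity (\sum_(1 <= l < (size s).+2)
    (G (E (take l (x :: s)) :: drop l (x :: s))
     + \sum_(0 <= a < (size s).+1 - l)
      G (tau x :: map tau (take a s) ++ E (take l (drop a s)) :: drop (a + l) s))).
  rewrite big_split; congr (_ + _); rewrite [RHS]big_nat_recr //=.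
  by rewrite subnn [X in _ + X]big_geq // addr0.
apply: eq_big_nat => l /andP[l0 ls]; rewrite [in RHS]subSn // big_nat_recl //.

Qed.

End CoderBySize.

(** * The sums over A(n), B(n), C(n) in suspended form *)

Section SuspendedSums.
Variable R : comPzRingType.

(** The definitions speak of [m n] only for [n >= 2]. Setting the lower arities to 0 makes the
    suspension multiadditive and without linear part; the differential is added separately. *)
Definition cut (V W : gradedModule R) (m : nat -> seq V -> W) (n : nat) : seq V -> W :=
  if (1 < n)%N then m n else fun=> 0.

Lemma susp_cut (V W : gradedModule R) (m : nat -> seq V -> W) s :
  susp (cut m) s = if (1 < size s)%N then susp m s else 0.
Proof. by rewrite /susp /cut; case: ifP => //; rewrite scaler0. Qed.

Lemma multilinear_zero (V W : gradedModule R) n : multilinear n (fun _ : seq V => 0 : W).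
Proof. by move=> s t a x y _; rewrite scaler0 addr0. Qed.

Lemma multiadd_susp_cut (V W : gradedModule R) (m : nat -> seq V -> W) :
  (forall n, (1 < n)%N -> multilinear n (m n)) -> multiadd (susp (cut m)).
Proof.
move=> mlin; apply: multiadd_susp => n _; rewrite /cut.
by case: ifP => [/mlin//|_]; apply: multilinear_zero.
Qed.

Lemma Bsum_susp (U V W : gradedModule R) (m : nat -> seq V -> W)
    (f : nat -> seq U -> V) s :
  (forall n, (1 < n)%N -> multilinear n (m n)) ->
  (forall j, (0 < j)%N -> graded_map j (j%:Z - 1) (f j)) -> s != [::] ->
  (-1) ^+ 'C(size s, 2) *: Bsum m f (size s) (twist s)
  = blocks (susp f) (susp (cut m)) s.
Proof.
move=> mlin fgr s0; rewrite (@blocks_trunc _ _ _ _ (susp m)) // => [|w _]; last first.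
  exact: susp_cut.
rewrite /Bsum sumB_wcomp scaler_sumr; apply: eq_big_nat => k /andP[k1 _].
rewrite scaler_sumr; apply: eq_big_seq => r /mem_wcomp[rk rs /allP r0].
rewrite (tensor_blocks (F := f) (G := m (size r))) //; last 2 first.
- by move=> j /r0/fgr.
- by rewrite rk; apply: mlin.
rewrite /susp size_map size_reshape !scalerA -!exprD; congr (_ *: _).
by apply: sign_parity; rewrite -rs odd_blocks_sign.
Qed.

Lemma Csum_susp (V : gradedModule R) (mu chi H : nat -> seq V -> V) s :
  (forall n, (1 < n)%N -> multilinear n (mu n)) ->
  (forall j, (0 < j)%N -> graded_map j (j%:Z - 1) (chi j)) ->
  (forall j, (0 < j)%N -> graded_map j j%:Z (H j)) -> s != [::] ->
  (-1) ^+ 'C(size s, 2) *: Csum mu chi H (size s) (twist s)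
  = coder (@odd_inv R V \o susp chi) (susp H) (unary1 id) (susp (cut mu)) s.
Proof.
move=> mulin chigr Hgr s0.
rewrite (@coder_trunc _ _ _ _ (susp (cut mu))) //; last 2 first.
- exact: multiadd_susp_cut.
- by move=> w _; rewrite !susp_cut; case: ifP.
rewrite /Csum sumC_wcomp scaler_sumr; apply: eq_big_nat => k /andP[k1 ks].
rewrite scaler_sumr; apply: eq_big_nat => i /andP[i0 ik].
rewrite scaler_sumr; apply: eq_big_seq => r /mem_wcomp[ri rs r0].
case/lastP: r ri rs r0 => [i_eq|u l]; first by rewrite -i_eq in i0.
rewrite size_rcons sumn_rcons all_rcons => iu ul /andP[l0 /allP u0].
rewrite last_rcons -iu /= -cats1 take_size_cat // cats1 coder_word_rcons -catA /=.
have kE : (size u + (k - (size u).+1).+1 = k)%N by clear -ik iu; lia.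
have nE : (sumn u + l + (k - (size u).+1) = size s)%N by clear -ul ks iu; lia.
rewrite (tensor_coder (H := H l) (G := mu k)); [ | by move=> j /u0/chigr | exact: Hgr
  | by [] | by rewrite kE; apply: mulin | exact: nE].
have szl : size (take l (drop (sumn u) s)) = l.
  by rewrite size_takel // size_drop; clear -nE; lia.
have szw v w : size (map v (reshape u s) ++ w :: drop (sumn u + l) s) = k.
  rewrite size_cat size_map size_reshape /= size_drop; move: nE kE; clear.
  by move: (size u) (size s) (sumn u) => x y z; lia.
rewrite susp_cut szw k1 /susp szl szw !scalerA -!exprD; congr (_ *: _).
apply: sign_parity; rewrite -[in RHS]kE -(odd_coder_sign u l) nE.
by rewrite !oddD !addbA.
Qed.

Lemma map_susp_id (V : gradedModule R) (a : nat) (phi : V -> V) (s : seq V) :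
  (a <= size s)%N ->
  map (phi \o susp (fun _ => unary id)) (reshape (nseq a 1%N) s) = map phi (take a s).
Proof.
elim: a s => [|a IHa] [|x s] //= sa; rewrite ?take0 //.
rewrite drop0 IHa //; congr (phi _ :: _).
by rewrite /susp /= ?take0 /= scale1r /unary /= koszul_even.
Qed.

Lemma odd_vartheta_nseq a l :
  odd (vartheta (rcons (nseq a 1%N) l)) = odd (a * l.+1).
Proof.
elim: a => [|a IHa]; first by rewrite /vartheta big_ord_recl !big_ord0.
rewrite -[nseq a.+1 1%N]/(1%N :: nseq a 1%N) rcons_cons vartheta_cons sumn_rcons size_rcons.
rewrite size_nseq sumn_nseq oddD IHa mul1n mul1n mulSn !oddD !oddM /=.
by case: (odd a) (odd l) => [] [].
Qed.

(** The identities before the inserted map form a family on blocks of length one, so this is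
    [tensor_coder] with [u = nseq a 1] and insertion position [a + 1]. The parity condition on [dl]
    admits both [mu l] and the differential. *)
Lemma insert_susp (V W : gradedModule R) (F : nat -> seq V -> W) (m : seq V -> V)
    l dl a s :
  graded_map l dl m -> odd (absz dl) = odd l -> (a + l <= size s)%N ->
  multilinear (size s - l).+1 (F (size s - l).+1) ->
  (-1) ^+ 'C(size s, 2) *: ((-1) ^+ (a.+1 * l.+1 + size s)
    *: F (size s - l).+1 (insert (size s - l).+1 a.+1 (TFactor l dl m) (twist s)))
  = - susp F (map (@odd_inv R V) (take a s)
      ++ ((-1) ^+ 'C(l, 2) *: m (twist (take l (drop a s)))) :: drop (a + l) s).
Proof.
move=> mgr dl_odd als; move Ek: (size s - l).+1 => k Flin.
rewrite /insert; move Ec: (k - a.+1)%N => c.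
have kE : (a + c.+1 = k)%N by clear -als Ek Ec; lia.
have nE : (a + l + c = size s)%N by clear -als Ek Ec; lia.
have as_ : (a <= size s)%N by clear -als; lia.
rewrite /=.
have -> : nseq a (idf V) = [seq TFactor j (j%:Z - 1) (unary id) | j <- nseq a 1%N].
  by rewrite map_nseq.
rewrite (tensor_coder (F := fun _ => unary id) (G := F k) _ mgr dl_odd);
  [ | | by rewrite size_nseq kE | by rewrite sumn_nseq mul1n].
  rewrite map_susp_id // sumn_nseq mul1n /susp.
  set w := _ ++ _; have -> : size w = k.
    by rewrite size_cat size_map size_takel //= size_drop; clear -nE kE; lia.
  rewrite !scalerA -scaleNr -!exprD -[in RHS]mulN1r -exprS; congr (_ *: _).
  have := odd_coder_sign (nseq a 1%N) l c; rewrite size_nseq sumn_nseq mul1n kE nE.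
  rewrite !oddD odd_vartheta_nseq => e; apply: sign_parity; move: e.
  move: 'C(_, 2) 'C(k, 2) (coder_sign _ _ _) => x y z; rewrite !oddS !oddD !oddM /=.
  by case: (odd a) (odd l) (odd x) (odd y) (odd z) (odd (size s))
    => [] [] [] [] [] [].
move=> j; rewrite mem_nseq => /andP[_ /eqP->]; split.
  by move=> [|? ?] [|? ?] b x y //= _; rewrite /unary /= scale1r.
by move=> [|e [|//]] [|x [|//]] //= _ _ /(_ 0%N isT) /= xe; rewrite big_seq1 addr0.
Qed.

End SuspendedSums.

(** The arity [l] determines [k]. The value [l = n] is missing because it would force [k = 1]: that
    is the term [f_1 mu_n], which the definitions list apart. *)
Lemma sumA_arity (M : nmodType) n (T : nat -> nat -> nat -> M) :
  sumA n T = \sum_(2 <= l < n) \sum_(0 <= a < n.+1 - l) T (n - l).+1 l a.+1.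
Proof.
rewrite /sumA; under eq_bigr do rewrite big_mkcond.
have [n1|n1] := leqP n 1; first by rewrite !big_geq // ltnW.
rewrite exchange_big /= big_nat_recr //= [X in _ + X]big_nat [X in _ + X]big1 ?addr0.
  apply: eq_big_nat => l /andP[l2 ln].
  rewrite (eq_bigr (fun k => if k == (n - l).+1 then \sum_(1 <= i < k.+1) T k l i else 0)).
    rewrite -big_mkcond big_nat1_eq ifT; last by clear -l2 ln; lia.
    rewrite big_add1 /= subSn //; exact: ltnW.
  by move=> k _; congr (if _ then _ else _); apply/eqP/eqP; clear -ln; lia.
by move=> k /andP[k2 _]; rewrite ifF //; clear -k2; lia.
Qed.

(** * The coderivation of a structure *)

Section SuspendedCoderivation.
Variables (R : comPzRingType) (V : chainComplex R).

Definition susp_diff (mu : nat -> seq V -> V) (s : seq V) : V :=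
  unary1 (cc_diff V) s + susp (cut mu) s.

Definition susp_coder (mu : nat -> seq V -> V) (M : zmodType) :
    (seq V -> M) -> seq V -> M :=
  coder (unary1 (@odd_inv R V)) (susp_diff mu) (unary1 id).

Lemma graded_map_unary (U W : gradedModule R) d (phi : {linear U -> W}) :
  (forall i x, homog i x -> homog (i + d) (phi x)) -> graded_map 1 d (unary phi).
Proof.
move=> phid; split; first by move=> [|? ?] [|? ?] b x y //= _; rewrite /unary /= linearP.
by move=> [|e [|//]] [|x [|//]] //= _ _ /(_ 0%N isT) /= xe; rewrite big_seq1; apply: phid.
Qed.

(** The position of the marked block being free, its length decides the origin of a term: length 1
    gives [dsum], intermediate lengths give [Asum], and the full length gives the term with
    [F 1]. *)
Lemma susp_coderE (W : gradedModule R) (mu : nat -> seq V -> V)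
    (F : nat -> seq V -> W) s :
  (forall n, (1 < n)%N -> graded_map n (n%:Z - 2) (mu n)) ->
  (forall n, (0 < n)%N -> multilinear n (F n)) -> (1 < size s)%N ->
  (-1) ^+ 'C(size s, 2) *: (dsum F (size s) (twist s) + Asum F mu (size s) (twist s)
     - F 1%N [:: mu (size s) (twist s)])
  = - susp_coder mu (susp F) s.
Proof.
move=> mugr Flin s2; rewrite /susp_coder coder_unary; last exact: multiadd_susp.
set n := size s in s2 *; rewrite big_ltn ?ltnS 1?ltnW // [X in _ = - (_ + X)]big_nat_recr //=.
rewrite !opprD scalerDr scalerDr -addrA; congr (_ + (_ + _)).
- rewrite /dsum scaler_sumr big_add1 /= subn1 -sumrN; apply: eq_big_nat => a /andP[_ an].
  have := @insert_susp _ _ _ F (unary (cc_diff V)) 1 (-1) a s.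
  rewrite subn1 prednK -/n ?addn1; last by clear -s2; lia.
  rewrite -[difff V]/(TFactor 1 (-1) (unary (cc_diff V))).
  (* For [l = 1] the sign of the A(n) summands reduces to that of [dsum]. *)
  move=> ins; rewrite (_ : (-1) ^+ n = (-1) ^+ (a.+1 * 2 + n)); last first.
    by apply: sign_parity; rewrite !oddD oddM andbF.
  rewrite ins //; last 2 first.
  + by apply: graded_map_unary => i x; apply: cc_diff_deg.
  + by apply: Flin; clear -s2; lia.
  congr (- susp F (_ ++ _ :: _)).
  have : size (drop a s) = (n - a)%N by rewrite size_drop.
  case: (drop a s) => [|y t] /=; first by clear -an; lia.
  by rewrite take0 /susp_diff susp_cut /= addr0 scale1r /unary /= koszul_even.
- rewrite /Asum sumA_arity scaler_sumr -sumrN; apply: eq_big_nat => l /andP[l2 ln].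
  rewrite scaler_sumr -sumrN; apply: eq_big_nat => a /andP[_ an].
  have aln : (a + l <= n)%N by clear -an ln; lia.
  rewrite (insert_susp (mugr l l2)) //; last 2 first.
  + by clear -l2; lia.
  + by apply: Flin.
  have szl : size (take l (drop a s)) = l by rewrite size_takel // size_drop; clear -aln; lia.
  rewrite /susp_diff susp_cut szl l2 /susp szl.
  congr (- _); case: (take l (drop a s)) szl => [|y [|y' t]] /=; rewrite ?add0r //;
    by move=> l_eq; rewrite -l_eq in l2.
rewrite subSnn big_nat1 take0 drop0 take_size add0n drop_size /=.
rewrite {1}/susp /= scale1r koszul_even //; rewrite scalerN; congr (- _).
rewrite -(multilinearZ (Flin 1%N isT) (s := [::]) (t := [::])) //=; congr (F _ [:: _]).
rewrite /susp_diff susp_cut s2 /susp -/n.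
by move: s2; rewrite /n; case: (s) => [|y [|y' t]] //= _; rewrite add0r.
Qed.

End SuspendedCoderivation.

(** * Degrees of the kernels *)

Section GradedMapTheory.
Variable R : comPzRingType.

Lemma eq_graded_map (V W : gradedModule R) n d (F G : seq V -> W) :
  (forall s, size s = n -> F s = G s) -> graded_map n d F -> graded_map n d G.
Proof.
move=> FG [Fn Fd]; split=> [s t a x y st|e s en sn eh].
  have sz z : size (s ++ z :: t) = n by rewrite size_cat /= addnS.
  by rewrite -!FG // Fn.
by rewrite -FG //; apply: Fd.
Qed.

Lemma graded_mapZ (V W : gradedModule R) n d (F : seq V -> W) a :
  graded_map n d F -> graded_map n d (fun s => a *: F s).
Proof.
move=> [Fn Fd]; split=> [s t b x y st|e s en sn eh].
  by rewrite Fn // scalerDr !scalerA mulrC.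
by apply: homogZ; apply: Fd.
Qed.

Lemma graded_mapD (V W : gradedModule R) n d (F G : seq V -> W) :
  graded_map n d F -> graded_map n d G -> graded_map n d (fun s => F s + G s).
Proof.
move=> [Fn Fd] [Gn Gd]; split=> [s t b x y st|e s en sn eh].
  by rewrite Fn // Gn // scalerDr addrACA.
by apply: homogD; [apply: Fd | apply: Gd].
Qed.

Lemma graded_map0 (V W : gradedModule R) n d :
  graded_map n d (fun _ : seq V => 0 : W).
Proof. by split; [apply: multilinear_zero | move=> *; apply: homog0]. Qed.

Lemma graded_map_sum (V W : gradedModule R) n d (I : eqType) (r : seq I)
    (F : I -> seq V -> W) :
  (forall i, i \in r -> graded_map n d (F i)) ->
  graded_map n d (fun s => \sum_(i <- r) F i s).
Proof.
elim: r => [|i r IHr] Fr.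
  by apply: eq_graded_map (graded_map0 _ _ _ _) => s _; rewrite big_nil.
apply: (@eq_graded_map _ _ _ _ (fun s => F i s + \sum_(j <- r) F j s)).
  by move=> s _; rewrite big_cons.
apply: graded_mapD; first by apply: Fr; apply: mem_head.
by apply: IHr => j jr; apply: Fr; rewrite inE jr orbT.
Qed.

Lemma graded_map_nat_sum (V W : gradedModule R) n d a b (F : nat -> seq V -> W) :
  (forall i, (a <= i < b)%N -> graded_map n d (F i)) ->
  graded_map n d (fun s => \sum_(a <= i < b) F i s).
Proof.
by move=> Fab; apply: graded_map_sum => i; rewrite mem_index_iota; apply: Fab.
Qed.

Lemma graded_unaryP (V W : gradedModule R) d (phi : V -> W) i x :
  graded_map 1 d (unary phi) -> homog i x -> homog (i + d) (phi x).
Proof.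
move=> [_ phid] xi; have := phid [:: i] [:: x] erefl erefl.
by rewrite big_seq1; apply => -[].
Qed.

Lemma graded_map_comp (U V W : gradedModule R) n d d' (phi : {linear V -> W})
    (F : seq U -> V) :
  graded_map 1 d' (unary phi) -> graded_map n d F ->
  graded_map n (d + d') (fun s => phi (F s)).
Proof.
move=> phid [Fn Fd]; split=> [s t b x y st|e s en sn eh].
  by rewrite Fn // linearP.
by rewrite addrA; apply: graded_unaryP => //; apply: Fd.
Qed.

Lemma graded_id (V : gradedModule R) : graded_map 1 0 (unary (@id V)).
Proof.
split; first by move=> [|? ?] [|? ?] b x y.
by move=> [|e [|//]] [|x [|//]] //= _ _ /(_ 0%N isT) /= xe; rewrite big_seq1 addr0.
Qed.

Fixpoint graded_factors (U V : gradedModule R) (fs : seq (tfactor U V)) : Prop :=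
  if fs is f :: fs' then graded_map (tf_arity f) (tf_deg f) (tf_fun f)
                         /\ graded_factors fs'
  else True.

Lemma graded_factors_cat (U V : gradedModule R) (fs gs : seq (tfactor U V)) :
  graded_factors fs -> graded_factors gs -> graded_factors (fs ++ gs).
Proof. by elim: fs => //= f fs IHfs [fgr /IHfs h] /h. Qed.

Lemma graded_factors_blocks (U V : gradedModule R) (F : nat -> seq U -> V) r :
  (forall j, j \in r -> graded_map j (j%:Z - 1) (F j)) ->
  graded_factors [seq TFactor j (j%:Z - 1) (F j) | j <- r].
Proof.
elim: r => //= j r IHr Fr; split; first by apply: Fr; apply: mem_head.
by apply: IHr => i ir; apply: Fr; rewrite inE ir orbT.
Qed.

Lemma graded_factors_idf (V : gradedModule R) c : graded_factors (nseq c (idf V)).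
Proof. by elim: c => //= c IHc; split=> //; apply: graded_id. Qed.

Lemma multilinear_tensor (U V W : gradedModule R) (fs : seq (tfactor U V))
    (m : seq V -> W) : graded_factors fs -> multilinear (size fs) m ->
  multilinear (\sum_(f <- fs) tf_arity f)%N (fun s => m (tensor fs s)).
Proof.
elim: fs m => [|f fs IHfs] m; first by move=> _ _ s t a x y; rewrite big_nil.
move=> [[fn _] fsgr] mn s t a x y; rewrite big_cons /=.
set k := \sum_(f' <- fs) tf_deg f'.
have [sf st|fs_ st] := ltnP (size s) (tf_arity f).
  have takeE z : take (tf_arity f) (s ++ z :: t)
      = s ++ z :: take (tf_arity f - (size s).+1) t.
    rewrite take_cat ltnNge (ltnW sf) /= -[in LHS](subnKC sf) addSnnS addKn //.
  have dropE z : drop (tf_arity f) (s ++ z :: t)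
      = drop (tf_arity f - (size s).+1) t.
    by rewrite drop_cat ltnNge (ltnW sf) /= -[in LHS](subnKC sf) addSnnS addKn.
  rewrite !takeE !dropE !map_cat /= linearP fn.
    by apply: (mn [::]); rewrite /= size_tensor.
  rewrite !size_map size_takel; first by clear -sf; lia.
  by clear -st sf; lia.
have takeE z : take (tf_arity f) (s ++ z :: t) = take (tf_arity f) s.
  by rewrite takel_cat.
have dropE z : drop (tf_arity f) (s ++ z :: t) = drop (tf_arity f) s ++ z :: t.
  rewrite drop_cat; case: ltngtP fs_ => // -> _.
  by rewrite subnn drop0 drop_size.
rewrite !takeE !dropE; apply: (IHfs (fun w => m (_ :: w))) => //.
  exact: multilinear_cons.
by rewrite size_drop; clear -fs_ st; lia.
Qed.

Lemma has_degree_tensor (U V W : gradedModule R) (fs : seq (tfactor U V))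
    (m : seq V -> W) d : graded_factors fs -> has_degree (size fs) d m ->
  has_degree (\sum_(f <- fs) tf_arity f)%N (d + \sum_(f <- fs) tf_deg f)
    (fun s => m (tensor fs s)).
Proof.
elim: fs m d => [|f fs IHfs] m d.
  move=> _ md e s; rewrite !big_nil addr0 => /size0nil-> /size0nil-> _.
  by have := md [::] [::] erefl erefl; rewrite big_nil; apply.
move=> [[_ fd] fsgr] md e s; rewrite !big_cons => en sn eh /=.
set N := (\sum_(f <- fs) tf_arity f)%N in en sn eh.
set k := \sum_(f' <- fs) tf_deg f'.
have fN : (tf_arity f <= tf_arity f + N)%N by apply: leq_addr.
set v := tf_fun f _.
have vh : homog (\sum_(i <- take (tf_arity f) e) i + tf_deg f) v.
  apply: fd; rewrite ?size_map ?size_takel ?en ?sn // => j jf.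
  rewrite (nth_map 0) ?size_takel ?sn // !nth_take //; apply: homog_koszul.
  by apply: eh; apply: leq_trans fN.
have := IHfs (fun w => m (v :: w)) (\sum_(i <- take (tf_arity f) e) i + tf_deg f + d) fsgr.
rewrite -{3}(cat_take_drop (tf_arity f) e) big_cat /=.
set x := \sum_(i <- take _ e) i; set y := \sum_(i <- drop _ e) i => IH.
have -> : x + y + (d + (tf_deg f + k)) = y + (x + tf_deg f + d + k).
  by clear; lia.
apply: IH => [e' s' e'n s'n e'h||| j jN].
- have := md ((x + tf_deg f) :: e') (v :: s'); rewrite /= e'n s'n big_cons.
  have -> : x + tf_deg f + \sum_(i <- e') i + d
      = \sum_(i <- e') i + (x + tf_deg f + d) by move: (\sum_(i <- e') i) => z; clear; lia.
  apply=> // -[|j] //= jn; exact: e'h.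
- by rewrite size_drop en addKn.
- by rewrite size_drop sn addKn.
- by rewrite !nth_drop; apply: eh; rewrite ltn_add2l.
Qed.

Lemma graded_map_tensor (U V W : gradedModule R) (fs : seq (tfactor U V))
    (m : seq V -> W) d : graded_factors fs -> graded_map (size fs) d m ->
  graded_map (\sum_(f <- fs) tf_arity f)%N (d + \sum_(f <- fs) tf_deg f)
    (fun s => m (tensor fs s)).
Proof.
by move=> fsgr [mn md]; split; [apply: multilinear_tensor | apply: has_degree_tensor].
Qed.

End GradedMapTheory.

Section GradedKernels.
Variable R : comPzRingType.

(** At least two positive parts force each part below the total; this makes the recursion for the
    kernels descend in arity. *)
Lemma wcomp_lt k n r j : r \in wcomp k n -> (1 < k)%N -> j \in r -> (0 < j < n)%N.
Proof.
move=> /mem_wcomp[rk rn /allP r0] k1 jr; rewrite (r0 _ jr) /=.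
rewrite -rn (perm_sumn (perm_to_rem jr)) sumn_cons -[X in (X < _)%N]addn0 ltn_add2l.
have : size (rem j r) != 0%N by rewrite size_rem // rk; clear -k1; lia.
have : {subset rem j r <= r} by apply: mem_rem.
case: (rem j r) => // i u sub _; rewrite sumn_cons addn_gt0.
by have /= -> := r0 i (sub i (mem_head _ _)).
Qed.

(** The shift [c] is 0 for the kernels [p], and 1 where the outer map is [h p]. *)
Lemma graded_Bsum (U V W : gradedModule R) (m : nat -> seq V -> W)
    (f : nat -> seq U -> V) n c :
  (forall k, (1 < k)%N -> graded_map k (k%:Z - 2 + c) (m k)) ->
  (forall j, (0 < j < n)%N -> graded_map j (j%:Z - 1) (f j)) ->
  graded_map n (n%:Z - 2 + c) (Bsum m f n).
Proof.
move=> mgr fgr; apply: (@eq_graded_map _ _ _ _ _ (fun s =>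
    \sum_(2 <= k < n.+1) \sum_(r <- wcomp k n) (-1) ^+ vartheta r *:
      m (size r) (tensor [seq TFactor j (j%:Z - 1) (f j) | j <- r] s))).
  by move=> s _; rewrite /Bsum sumB_wcomp.
apply: graded_map_nat_sum => k /andP[k1 _]; apply: graded_map_sum => r rk.
apply: graded_mapZ; have [szr rn _] := mem_wcomp rk.
have := @graded_map_tensor _ _ _ _ [seq TFactor j (j%:Z - 1) (f j) | j <- r]
  (m (size r)) (k%:Z - 2 + c).
rewrite size_map szr big_map -sumnE sum_deg_blocks rn szr.
have -> : k%:Z - 2 + c + (n%:Z - k%:Z) = n%:Z - 2 + c by clear; lia.
apply; last exact: mgr.
by apply: graded_factors_blocks => j /(wcomp_lt rk k1)/fgr.
Qed.

Lemma graded_Csum (V : gradedModule R) (mu chi H : nat -> seq V -> V) n :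
  (forall k, (1 < k)%N -> graded_map k (k%:Z - 2) (mu k)) ->
  (forall j, (0 < j < n)%N -> graded_map j (j%:Z - 1) (chi j)) ->
  (forall j, (0 < j < n)%N -> graded_map j j%:Z (H j)) ->
  graded_map n (n%:Z - 1) (Csum mu chi H n).
Proof.
move=> mugr chigr Hgr; apply: (@eq_graded_map _ _ _ _ _ (fun s =>
    \sum_(2 <= k < n.+1) \sum_(1 <= i < k.+1) \sum_(r <- wcomp i (n - (k - i))%N)
      (-1) ^+ (n + last 0%N r + vartheta r) *:
    mu k (tensor ([seq TFactor j (j%:Z - 1) (chi j) | j <- take i.-1 r]
                  ++ TFactor (last 0%N r) (last 0%N r)%:Z (H (last 0%N r))
                  :: nseq (k - i) (idf V)) s))).
  by move=> s _; rewrite /Csum sumC_wcomp.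
apply: graded_map_nat_sum => k /andP[k1 kn].
apply: graded_map_nat_sum => i /andP[i0 ik].
apply: graded_map_sum => r ri; apply: graded_mapZ; have [szr rn r0] := mem_wcomp ri.
have r_lt j : j \in r -> (0 < j < n)%N.
  move=> jr; have [i1|i1] := ltnP 1 i.
    have /andP[-> jn] := wcomp_lt ri i1 jr.
    by apply: leq_trans jn _; apply: leq_subr.
  have j0 := allP r0 _ jr; rewrite [(0 < j)%N]j0 /=.
  have : (j <= sumn r)%N by rewrite (perm_sumn (perm_to_rem jr)) sumn_cons leq_addr.
  by rewrite rn; clear -i1 k1 kn; lia.
case/lastP: r szr rn r_lt {ri r0} => [i_eq|u l]; first by rewrite -i_eq in i0.
rewrite size_rcons sumn_rcons last_rcons => iu ul r_lt.
rewrite -iu /= -cats1 take_size_cat //.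
set fs := _ ++ _; have := @graded_map_tensor _ _ _ _ fs (mu k) (k%:Z - 2).
rewrite /fs size_cat size_map /= size_nseq !big_cat !big_cons big_map -sumnE.
rewrite sum_deg_blocks sum_deg_idf /=.
have -> : (\sum_(f <- nseq (k - (size u).+1) (idf V)) tf_arity f = k - (size u).+1)%N.
  by move: (k - _)%N => c; elim: c => [|c IHc]; rewrite ?big_nil //= big_cons IHc.
have -> : (size u + (k - (size u).+1).+1 = k)%N by clear -iu ik; lia.
have -> : (sumn u + (l + (k - (size u).+1)) = n)%N by clear -ul kn iu ik; lia.
have -> : k%:Z - 2 + ((sumn u)%:Z - (size u)%:Z + (l%:Z + 0)) = n%:Z - 1.
  by clear -ul kn iu ik; lia.
apply; last exact: mugr.
apply: graded_factors_cat.
  by apply: graded_factors_blocks => j ju; apply/chigr/r_lt; rewrite mem_rcons inE ju orbT.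
split; last exact: graded_factors_idf.
by apply/Hgr/r_lt; rewrite mem_rcons mem_head.
Qed.

Variables (V : gradedModule R) (mu : nat -> seq V -> V) (gf h : {linear V -> V}).
Hypothesis mu_graded : forall k, (1 < k)%N -> graded_map k (k%:Z - 2) (mu k).
Hypothesis gf_graded : graded_map 1 0 (unary gf).
Hypothesis h_graded : graded_map 1 1 (unary h).

Let p := p_kernel mu h.
Let q := q_kernel mu gf h.

Lemma graded_hp_from n :
  (forall j, (1 < j < n)%N -> graded_map j (j%:Z - 2) (p j)) ->
  forall j, (0 < j < n)%N -> graded_map j (j%:Z - 1) (hp h p j).
Proof.
move=> pgr j /andP[j0 jn]; rewrite /hp /with_first.
case: eqP => [->|/eqP j1]; first exact: graded_id.
have -> : j%:Z - 1 = j%:Z - 2 + 1 by clear; lia.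
apply: graded_map_comp => //; apply: pgr; rewrite jn andbT.
by clear -j0 j1; lia.
Qed.

Lemma graded_p n : graded_map n (n%:Z - 2) (p n).
Proof.
elim/ltn_ind: n => n IHn; rewrite -[_ - 2]addr0.
apply: (@eq_graded_map _ _ _ _ _ (Bsum mu (hp h p) n)).
  by move=> s _; rewrite -p_kernelE.
apply: graded_Bsum => [k k1|]; first by rewrite addr0; apply: mu_graded.
by apply: graded_hp_from => j /andP[_ jn]; apply: IHn.
Qed.

Lemma graded_hp n : (0 < n)%N -> graded_map n (n%:Z - 1) (hp h p n).
Proof.
by move=> n0; apply: (@graded_hp_from n.+1) => [j _|]; [apply: graded_p | rewrite n0 /=].
Qed.

Lemma graded_psiphi_from n : (0 < n)%N ->
  (forall j, (0 < j <= n)%N -> graded_map j (j%:Z - 1) (q j)) ->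
  graded_map n (n%:Z - 1) (psiphi mu gf h q n).
Proof.
move=> n0 qgr.
have gfq j : (0 < j <= n)%N -> graded_map j (j%:Z - 1) (fun s => gf (q j s)).
  by move=> /qgr qj; rewrite -[_ - 1]addr0; apply: graded_map_comp.
apply: graded_mapD; first by apply: gfq; rewrite n0 /=.
have -> : n%:Z - 1 = n%:Z - 2 + 1 by clear; lia.
apply: graded_Bsum => [k _|j /andP[j0 jn]].
  by apply: graded_map_comp => //; apply: graded_p.
by apply: gfq; rewrite j0 ltnW.
Qed.

Lemma graded_q n : (0 < n)%N -> graded_map n (n%:Z - 1) (q n).
Proof.
elim/ltn_ind: n => n IHn n0; have [n1|n1] := ltnP 1 n; last first.
  have -> : n = 1%N by clear -n0 n1; lia.
  apply: (@eq_graded_map _ _ _ _ _ (unary id)); last exact: graded_id.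
  by move=> [|x [|//]].
apply: (@eq_graded_map _ _ _ _ _ (Csum mu (psiphi mu gf h q) (fun r t => h (q r t)) n)).
  by move=> s _; rewrite -q_kernelE.
apply: graded_Csum => [//|j /andP[j0 jn]|j /andP[j0 jn]].
  apply: graded_psiphi_from => // i /andP[i0 ij]; apply: IHn => //.
  exact: leq_ltn_trans jn.
have -> : j%:Z = j%:Z - 1 + 1 by clear; lia.
by apply: graded_map_comp => //; apply: IHn.
Qed.

Lemma graded_psiphi n : (0 < n)%N -> graded_map n (n%:Z - 1) (psiphi mu gf h q n).
Proof.
by move=> n0; apply: graded_psiphi_from => // j /andP[j0 _]; apply: graded_q.
Qed.

End GradedKernels.

(** * Translation of the A-infinity equations *)

Section Translation.
Variable R : comPzRingType.

Lemma odd_inv_is_linear (V : gradedModule R) : linear (@odd_inv R V).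
Proof. by move=> a x y; rewrite /odd_inv linearP opprD scalerN. Qed.

HB.instance Definition _ (V : gradedModule R) :=
  GRing.isLinear.Build R V V *:%R (@odd_inv R V) (@odd_inv_is_linear V).

Lemma odd_invK (V : gradedModule R) : involutive (@odd_inv R V).
Proof. by move=> x; rewrite /odd_inv linearN /= opprK koszulK. Qed.

Lemma koszul_comm (V W : gradedModule R) d (phi : V -> W) b x :
  graded_map 1 d (unary phi) ->
  phi (koszul b x) = (-1) ^+ absz (d * b) *: koszul b (phi x).
Proof. by move=> phid; have := graded_map_koszul b (s := [:: x]) phid erefl. Qed.

Lemma odd_inv_comm (V W : gradedModule R) d (phi : {linear V -> W}) x :
  graded_map 1 d (unary phi) ->
  phi (odd_inv x) = (-1) ^+ absz d *: odd_inv (phi x).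
Proof.
by move=> phid; rewrite /odd_inv linearN (koszul_comm _ _ phid) mulr1 scalerN.
Qed.

Lemma susp_linear (U V W : gradedModule R) (phi : {linear V -> W})
    (F : nat -> seq U -> V) s :
  susp (fun n t => phi (F n t)) s = phi (susp F s).
Proof. by rewrite /susp linearZ. Qed.

Lemma eq_susp (V W : gradedModule R) (F G : nat -> seq V -> W) s :
  (forall t, size t = size s -> F (size s) t = G (size s) t) -> susp F s = susp G s.
Proof. by move=> FG; rewrite /susp FG ?size_twist. Qed.

Lemma signZ_inj (M : lmodType R) n (x y : M) :
  (-1) ^+ n *: x = (-1) ^+ n *: y -> x = y.
Proof.
by move=> /(congr1 ( *:%R ((-1) ^+ n))); rewrite !scalerA -exprD addnn -signr_odd
  odd_double !scale1r.
Qed.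

Lemma coder_letter (V W M : zmodType) (A E B : seq V -> W) (G : seq W -> M) x :
  multiadd G -> coder A E B G [:: x] = G [:: E [:: x]].
Proof. by move=> Gadd; rewrite coder_cons // big_cuts0 coder0 blocks0 add0r. Qed.

Lemma blocks_letter (V W M : zmodType) (A : seq V -> W) (G : seq W -> M) x :
  blocks A G [:: x] = G [:: A [:: x]].
Proof. by rewrite blocks_cons big_cuts0 blocks0. Qed.

Variable V : chainComplex R.
Variable mu : nat -> seq V -> V.
Hypothesis mu_graded : forall n, (1 < n)%N -> graded_map n (n%:Z - 2) (mu n).

Let mu_lin n (n1 : (1 < n)%N) : multilinear n (mu n) := (mu_graded n1).1.

Lemma susp_diff_letter x : susp_diff mu [:: x] = \d x.
Proof. by rewrite /susp_diff susp_cut addr0. Qed.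

Lemma susp_diff_word s : (1 < size s)%N -> susp_diff mu s = susp mu s.
Proof.
by rewrite /susp_diff susp_cut; case: s => [|x [|y s]] //= _; rewrite add0r.
Qed.

Lemma susp_diff_square s : (1 < size s)%N ->
  susp_coder mu (susp_diff mu) s
  = (-1) ^+ 'C(size s, 2) *: (\d (mu (size s) (twist s))
      - dsum mu (size s) (twist s) - Asum mu mu (size s) (twist s)).
Proof.
move=> s2; have s0 : s != [::] by case: (s) s2.
rewrite /susp_coder coder_add coder_unary1 // susp_diff_word // -/(susp_coder _ _ _).
have cut_lin n : (0 < n)%N -> multilinear n (cut mu n).
  by rewrite /cut; case: ifP => [/mu_lin//|_ _]; apply: multilinear_zero.
have := susp_coderE mu_graded cut_lin s2.
rewrite {3}/cut /= subr0 => /(congr1 -%R); rewrite opprK => <-.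
rewrite -scalerN -addrA -opprD [RHS]scalerDr; congr (_ + _ *: - (_ + _)).
- by rewrite /susp linearZ.
- by apply: eq_bigr => i _; rewrite /cut s2.
- by rewrite /Asum; apply: eq_big_nat => k /andP[k2 _]; rewrite /cut k2.
Qed.

(** On one letter the square is [d (d x)], which vanishes in a complex. Longer words give the
    suspended relations; the converse evaluates at [twist s] to reach an arbitrary [s]. *)
Lemma Ainf_susp : Ainf_algebra mu <->
  forall s, s != [::] -> susp_coder mu (susp_diff mu) s = 0.
Proof.
split=> [mu_Ainf [//|x [|y s]] _ | square0 n n1].
- rewrite /susp_coder coder_letter ?susp_diff_letter ?cc_diff2 //.
  move=> t t' u v; rewrite /susp_diff multiadd_susp_cut //.
  by rewrite (multiadd_unary1 (raddfD (cc_diff V))) addrACA.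
- set t := x :: _; rewrite susp_diff_square //; have [_ e] := mu_Ainf (size t) isT.
  by rewrite e ?size_twist // subrr scaler0.
split=> [|s sn]; first exact: mu_graded.
have := square0 (twist s); rewrite -size_eq0 size_twist sn -lt0n (ltnW n1) => /(_ isT).
rewrite susp_diff_square ?size_twist ?sn // twistK => /(congr1 ( *:%R ((-1) ^+ 'C(n, 2)))).
rewrite scalerA -exprD addnn -signr_odd odd_double scale1r scaler0 => /eqP.
by rewrite subr_eq0 => /eqP.
Qed.

Lemma morphism_susp (W : chainComplex R) (nu : nat -> seq W -> W)
    (F : nat -> seq V -> W) :
  (forall n, (1 < n)%N -> multilinear n (nu n)) ->
  (forall n, (0 < n)%N -> graded_map n (n%:Z - 1) (F n)) ->
  (forall s, s != [::] ->
     blocks (susp F) (susp_diff nu) s = susp_coder mu (susp F) s) ->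
  Ainf_morphism mu nu F.
Proof.
move=> nu_lin Fgr Fmor.
have F_lin n : (0 < n)%N -> multilinear n (F n) by move=> /Fgr[].
have F1 x : susp F [:: x] = F 1%N [:: x].
  by rewrite /susp /= scale1r koszul_even.
split; last first.
  move=> n n1; split; first by apply: Fgr; apply: ltnW.
  move=> s sn; apply: (@signZ_inj _ 'C(n, 2)); move: sn.
  rewrite -[s]twistK size_twist; set t := twist s => tn.
  have t0 : t != [::] by rewrite -size_eq0 tn -lt0n ltnW.
  have := Fmor t t0; have := susp_coderE mu_graded F_lin; move=> /(_ t).
  rewrite tn => /(_ n1) Dt.
  rewrite /susp_diff blocks_add blocks_unary1 // -Bsum_susp // tn.
  rewrite {1}/susp tn linearZ /= -scalerDr => ->.
  by rewrite -[susp_coder _ _ _]opprK -Dt -scalerN !opprD opprK; congr (_ *: _); rewrite addrC addrA.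
split.
  apply: (@eq_graded_map _ _ _ _ _ (F 1%N)); last exact: Fgr.
  by move=> [|x [|//]].
move=> x; have := Fmor [:: x] isT; rewrite blocks_letter F1.
rewrite /susp_coder coder_letter; last exact: multiadd_susp.
by rewrite susp_diff_letter F1 /susp_diff /= susp_cut addr0.
Qed.

End Translation.

(** * Translation of homotopies and of the relation for q *)

Section HomotopyTranslation.
Variables (R : comPzRingType) (V : chainComplex R).
Variable mu : nat -> seq V -> V.
Hypothesis mu_graded : forall n, (1 < n)%N -> graded_map n (n%:Z - 2) (mu n).

Lemma susp_letter (W : gradedModule R) (F : nat -> seq V -> W) x :
  susp F [:: x] = F 1%N [:: x].
Proof. by rewrite /susp /= scale1r koszul_even. Qed.

Lemma multiadd_susp_diff : multiadd (susp_diff mu).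
Proof.
move=> s t x y; rewrite /susp_diff multiadd_susp_cut => [|n /mu_graded[]//].
by rewrite (multiadd_unary1 (raddfD (cc_diff V))) addrACA.
Qed.

Lemma homotopy_susp (chi H : nat -> seq V -> V) :
  (forall n, (0 < n)%N -> graded_map n (n%:Z - 1) (chi n)) ->
  (forall n, (0 < n)%N -> graded_map n n%:Z (H n)) ->
  (forall s, s != [::] ->
     susp_coder mu (susp H) s
     + coder (@odd_inv R V \o susp chi) (susp H) (unary1 id) (susp_diff mu) s
     = susp chi s - unary1 id s) ->
  Ainf_morphism mu mu chi -> Ainf_homotopy_id mu chi H.
Proof.
move=> chigr Hgr htpy chi_mor.
have H_lin n : (0 < n)%N -> multilinear n (H n) by move=> /Hgr[].
have mu_lin n : (1 < n)%N -> multilinear n (mu n) by move=> /mu_graded[].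
split=> //; first exact: Hgr.
  move=> x; have := htpy [:: x] isT; rewrite /susp_coder !coder_letter //.
  - by rewrite !susp_diff_letter !susp_letter /= addrC => <-.
  - exact: multiadd_susp_diff.
  - exact: multiadd_susp.
move=> n n1; split; first by apply: Hgr; apply: ltnW.
move=> s sn; apply: (@signZ_inj _ _ 'C(n, 2)); move: sn.
rewrite -[s]twistK size_twist; set t := twist s => tn.
have t0 : t != [::] by rewrite -size_eq0 tn -lt0n ltnW.
have := htpy t t0; have := susp_coderE mu_graded H_lin; move=> /(_ t).
rewrite tn => /(_ n1) Dt.
rewrite coder_add coder_unary1 // -(Csum_susp mu_lin chigr Hgr) // tn.
have -> : unary1 id t = 0 by case: (t) tn n1 => [|x [|y t']] //= <-.
have suspE (F : nat -> seq V -> V) : susp F t = (-1) ^+ 'C(n, 2) *: F n (twist t).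
  by rewrite /susp tn.
rewrite subr0 !suspE linearZ /= => <-.
rewrite -[susp_coder _ _ _]opprK -Dt -scalerN -!scalerDr; congr (_ *: _).
by rewrite !opprD opprK [- _ - _ + _]addrC !addrA.
Qed.

Lemma relation_susp (p q : nat -> seq V -> V) (gf : V -> V) :
  (forall n, (1 < n)%N -> multilinear n (p n)) ->
  (forall n, (0 < n)%N -> graded_map n (n%:Z - 1) (q n)) ->
  (forall n, (0 < n)%N -> graded_map n (n%:Z - 1) (fun s => gf (q n s))) ->
  (forall s, s != [::] -> \d (susp q s)
    + blocks (susp (fun n s => gf (q n s))) (susp (cut p)) s
    = susp_coder mu (susp q) s) ->
  forall n s, (1 < n)%N -> size s = n ->
  \d (q n s) + dsum q n s + Bsum p (fun r t => gf (q r t)) n s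
  + Asum q mu n s - q 1%N [:: mu n s] = 0.
Proof.
move=> p_lin qgr gfqgr rel n s n1 sn.
have q_lin k : (0 < k)%N -> multilinear k (q k) by move=> /qgr[].
apply: (@signZ_inj _ _ 'C(n, 2)); move: sn.
rewrite -[s]twistK size_twist; set t := twist s => tn.
have t0 : t != [::] by rewrite -size_eq0 tn -lt0n ltnW.
have := rel t t0; have := susp_coderE mu_graded q_lin; move=> /(_ t).
rewrite tn => /(_ n1) Dt; rewrite -Bsum_susp // tn.
have suspE (F : nat -> seq V -> V) : susp F t = (-1) ^+ 'C(n, 2) *: F n (twist t).
  by rewrite /susp tn.
rewrite suspE linearZ /= => e.
rewrite scaler0; set x := \d _; set y := dsum _ _ _; set z := Bsum _ _ _ _.
have -> : x + y + z + Asum q mu n (twist t) - q 1%N [:: mu n (twist t)]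
    = x + z + (y + Asum q mu n (twist t) - q 1%N [:: mu n (twist t)]).
  by rewrite -!addrA; congr (_ + _); rewrite addrCA.
by rewrite scalerDr Dt scalerDr e subrr.
Qed.

End HomotopyTranslation.

(** * Precomposition with a map of degree 0 *)

Section Precomposition.
Variables (R : comPzRingType) (U V W : gradedModule R) (g : {linear U -> V}).
Hypothesis g_deg : graded_map 1 0 (unary g).

Lemma graded_map_map n d (F : seq V -> W) :
  graded_map n d F -> graded_map n d (fun s => F (map g s)).
Proof.
move=> [Fn Fd]; split=> [s t a x y st|e s en sn eh].
  by rewrite !map_cat /= linearP Fn ?size_map.
apply: Fd; rewrite ?size_map // => j jn.
rewrite (nth_map 0) ?sn // -[nth 0 e j]addr0.
by apply: graded_unaryP => //; apply: eh.
Qed.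

Lemma susp_map (F : nat -> seq V -> W) s :
  susp F (map g s) = susp (fun n t => F n (map g t)) s.
Proof.
rewrite /susp size_map twist_map // => b x.
by rewrite (koszul_comm _ _ g_deg) mul0r scale1r.
Qed.

Lemma tensor_nseq n (s : seq U) : size s = n ->
  tensor (nseq n (TFactor 1 0 (unary g))) s = map g s.
Proof.
have deg0 c : \sum_(f <- nseq c (TFactor 1 0 (unary g))) tf_deg f = 0.
  by elim: c => [|c IHc]; rewrite ?big_nil //= big_cons IHc.
elim: n s => [|n IHn] [|x s] //= [sn]; rewrite deg0 take0 drop0 IHn //.
by rewrite /unary /= koszul_even.
Qed.

End Precomposition.

(** * Matching the kernels with the suspended transfer, and unsuspending *)

Theorem theorem3p15 (R : comPzRingType) (V W : chainComplex R)
    (mu : nat -> seq V -> V)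
    (f : {linear V -> W}) (g : {linear W -> V}) (h : {linear V -> V})
    (mu_Ainf : Ainf_algebra mu)
    (f_chain : chain_map f) (g_chain : chain_map g)
    (h_deg : graded_map 1 1 (unary h))
    (gf_htpy : forall x : V, g (f x) - x = \d (h x) + h (\d x)) :
  let gf := fun x : V => g (f x) in
  let p := p_kernel mu h in
  let q := q_kernel mu gf h in
  let g_tensor := fun n : nat => tensor (nseq n (TFactor 1 0 (unary g))) in
  let nu := fun n s => f (p n (g_tensor n s)) in
  let phi := with_first f (fun n s => f (q n s)) in
  let psi := with_first g (fun n s => h (p n (g_tensor n s))) in
  let H := with_first h (fun n s => h (q n s)) in
  (forall n (s : seq V), (2 <= n)%N -> size s = n ->
     \d (q n s) + dsum q n s + Bsum p (fun r t => gf (q r t)) n s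
     + Asum q mu n s - q 1%N [:: mu n s] = 0) /\
  [/\ Ainf_algebra nu,
      Ainf_morphism mu nu phi,
      Ainf_morphism nu mu psi &
      Ainf_homotopy_id mu (Ainf_comp psi phi) H].
Proof.
move=> gf p q g_tensor nu phi psi H.
have [f_deg f_d] := f_chain; have [g_deg g_d] := g_chain.
have mu_gr n : (1 < n)%N -> graded_map n (n%:Z - 2) (mu n) by move=> /mu_Ainf[].
have mu_lin n : (1 < n)%N -> multilinear n (mu n) by move=> /mu_gr[].
have gf_deg : graded_map 1 0 (unary gf).
  rewrite -[0]addr0; apply: (@graded_map_comp _ _ _ _ _ _ _ g (unary f)) => //.
have p_gr n : graded_map n (n%:Z - 2) (p n) by apply: graded_p.
have hp_gr n : (0 < n)%N -> graded_map n (n%:Z - 1) (hp h p n) by apply: graded_hp.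
have q_gr n : (0 < n)%N -> graded_map n (n%:Z - 1) (q n).
  by apply: (@graded_q _ _ mu (g \o f) h).
have chi_gr n : (0 < n)%N -> graded_map n (n%:Z - 1) (psiphi mu gf h q n).
  by apply: (@graded_psiphi _ _ mu (g \o f) h).
have fq_gr n : (0 < n)%N -> graded_map n (n%:Z - 1) (fun s => f (q n s)).
  by move=> n0; rewrite -[_ - 1]addr0; apply: graded_map_comp => //; apply: q_gr.
have gfq_gr n : (0 < n)%N -> graded_map n (n%:Z - 1) (fun s => gf (q n s)).
  move=> n0; rewrite -[_ - 1]addr0.
  by apply: (@graded_map_comp _ _ _ _ _ _ _ (g \o f)) => //; apply: q_gr.
have hq_gr n : (0 < n)%N -> graded_map n n%:Z (fun s => h (q n s)).
  move=> n0; have -> : n%:Z = n%:Z - 1 + 1 by clear; lia.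
  by apply: graded_map_comp => //; apply: q_gr.
have hp'_gr n : graded_map n (n%:Z - 1) (fun s => h (p n s)).
  have -> : n%:Z - 1 = n%:Z - 2 + 1 by clear; lia.
  by apply: graded_map_comp.
have lin_gr n d (U U' : gradedModule R) (F : seq U -> U') : graded_map n d F -> multilinear n F.
  by case.
set P := susp (hp h p); set P0 := susp p; set Q := susp q.
set chi := susp (psiphi mu gf h q).
have d_gr (U : chainComplex R) : graded_map 1 (-1) (unary (cc_diff U)).
  by apply: graded_map_unary => i x; apply: cc_diff_deg.
have even_comm (U U' : gradedModule R) (a : {linear U -> U'}) x :
    graded_map 1 0 (unary a) -> a (odd_inv x) = odd_inv (a x).
  by move=> a0; rewrite (odd_inv_comm _ a0) scale1r.
have odd_comm (U U' : gradedModule R) (a : {linear U -> U'}) (e : int) x :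
    absz e = 1%N -> graded_map 1 e (unary a) -> a (odd_inv x) = - odd_inv (a x).
  by move=> e1 ae; rewrite (odd_inv_comm _ ae) e1 scaleN1r.
have even_susp (U U' : gradedModule R) (F : nat -> seq U -> U') s :
    (forall n, (0 < n)%N -> graded_map n (n%:Z - 1) (F n)) -> s != [::] ->
    susp F (map (@odd_inv R U) s) = odd_inv (susp F s).
  move=> Fgr s0; rewrite (@susp_odd_inv _ _ _ _ (-1)) ?scale1r //.
  by apply: Fgr; rewrite lt0n size_eq0.
(* In arity 1 the kernel [p] is an empty sum. Hence [P = 1 + h p] also holds on letters, and [cut]
   does not change the suspension of [p] on nonempty words. *)
have p1 x : p 1%N [:: x] = 0 by rewrite /p p_kernelE /Bsum /sumB big_geq.
have P0_letter x : P0 [:: x] = 0 by rewrite /P0 susp_letter p1.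
have cut_p (U : gradedModule R) (a : {linear V -> U}) w : w != [::] ->
    susp (cut (fun n s => a (p n s))) w = a (P0 w).
  move=> w0; rewrite susp_cut; case: ifP => [_|]; first exact: susp_linear.
  by case: w w0 => [|x [|y w]] //= _ _; rewrite P0_letter linear0.
have gfqE a : susp (fun n s => gf (q n s)) a = g (f (Q a)).
  exact: (susp_linear (g \o f)).
have PE s : s != [::] -> P s = unary1 id s + h (P0 s).
  case: s => [|x [|y s]] // _; first by rewrite /P susp_letter P0_letter linear0 addr0.
  by rewrite /= add0r -susp_linear; apply: eq_susp.
have pE s : s != [::] -> P0 s = blocks P (susp (cut mu)) s.
  move=> s0; rewrite -Bsum_susp // /P0 /susp; congr (_ *: _); exact: p_kernelE.
have chiE s : s != [::] -> chi s = blocks (g \o f \o Q) P s.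
  move=> s0; rewrite (eq_blocksr _ s0 PE) blocks_add blocks_unary1 //.
  rewrite /chi /susp /psiphi scalerDr; congr (_ + _).
    by rewrite -[gf _]/((g \o f) _) -linearZ.
  rewrite Bsum_susp //; last by move=> n _; apply: lin_gr (hp'_gr n).
  rewrite (@eq_blocks _ _ _ _ (g \o f \o Q)) => [|a _ _]; last exact: gfqE.
  by apply: eq_blocksr => // w w0; apply: cut_p.
have qE s : s != [::] -> Q s = unary1 id s
    + coder (@odd_inv R V \o chi) (h \o Q) (unary1 id) (susp (cut mu)) s.
  case: s => [|x [|y s]] // _.
    rewrite coder_letter ?susp_cut ?addr0 /Q ?susp_letter //.
    exact: multiadd_susp_cut.
  set t := [:: x, y & s]; rewrite /= add0r.
  rewrite -(@eq_coderE _ _ _ _ (susp (fun r u => h (q r u)))) => [|a _ _]; last exact: susp_linear.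
  rewrite -Csum_susp // /Q /susp; congr (_ *: _); exact: q_kernelE.
have [] := @suspended_transfer V W (@odd_inv R V) (cc_diff V) h (@odd_inv R W)
  (cc_diff W) f g (susp (cut mu)) P0 P Q chi.
- exact: odd_invK.
- by move=> x; apply: odd_comm (d_gr V).
- by move=> x; apply: odd_comm h_deg.
- by move=> x; apply: even_comm.
- by move=> x; apply: even_comm.
- exact: cc_diff2.
- exact: cc_diff2.
- exact: f_d.
- exact: g_d.
- exact: gf_htpy.
- exact: multiadd_susp_cut.
- by move=> v; rewrite susp_cut.
- move=> s s0; rewrite (@susp_odd_inv _ _ _ _ (-2)) ?scaleN1r //.
  by rewrite /cut; case: ifP => [/mu_gr//|_]; apply: graded_map0.
- exact: (Ainf_susp mu_gr).1 mu_Ainf.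
- by apply: multiadd_susp => n /hp_gr[].
- exact: pE.
- exact: PE.
- by move=> s; apply: even_susp.
- by apply: multiadd_susp => n /q_gr[].
- by apply: multiadd_susp => n /chi_gr[].
- exact: qE.
- exact: chiE.
- by move=> s; apply: even_susp.
- by move=> s; apply: even_susp.
move=> transferW transferV.
have nuE n s : size s = n -> f (p n (map g s)) = nu n s.
  by move=> sn; rewrite /nu /g_tensor tensor_nseq.
have nu_gr n : graded_map n (n%:Z - 2) (nu n).
  apply: (eq_graded_map (nuE n)); rewrite -[_ - 2]addr0.
  by apply: graded_map_comp => //; apply: graded_map_map.
have nu_lin n : (1 < n)%N -> multilinear n (nu n) by case: (nu_gr n).
have phiE n s : (0 < n)%N -> size s = n -> f (q n s) = phi n s.
  by case: n s => [|[|n]] // [|x [|]].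
have phi_gr n : (0 < n)%N -> graded_map n (n%:Z - 1) (phi n).
  by move=> n0; apply: eq_graded_map (fq_gr n n0) => s; apply: phiE.
have psiE n s : (0 < n)%N -> size s = n -> hp h p n (map g s) = psi n s.
  case: n s => [|[|n]] // => [[|x [|]] //|s _ sn].
  by rewrite /hp /psi /with_first /= /g_tensor tensor_nseq.
have psi_gr n : (0 < n)%N -> graded_map n (n%:Z - 1) (psi n).
  move=> n0; apply: (@eq_graded_map _ _ _ _ _ (fun s => hp h p n (map g s))).
    by move=> s; apply: psiE.
  by apply: graded_map_map => //; apply: hp_gr.
have HE n s : (0 < n)%N -> size s = n -> h (q n s) = H n s.
  by case: n s => [|[|n]] // [|x [|]].
have H_gr n : (0 < n)%N -> graded_map n n%:Z (H n).
  by move=> n0; apply: eq_graded_map (hq_gr n n0) => s; apply: HE.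
have susp_phi s : s != [::] -> susp phi s = f (Q s).
  move=> s0; rewrite -susp_linear; apply: eq_susp => t ts.
  by rewrite phiE ?lt0n ?size_eq0.
have susp_psiE s : s != [::] -> susp psi s = P (map g s).
  move=> s0; rewrite /P susp_map //; apply: eq_susp => t ts.
  by rewrite psiE ?lt0n ?size_eq0.
have susp_H s : s != [::] -> susp H s = h (Q s).
  move=> s0; rewrite -susp_linear; apply: eq_susp => t ts.
  by rewrite HE ?lt0n ?size_eq0.
have susp_nuE s : s != [::] -> susp (cut nu) s = f (P0 (map g s)).
  move=> s0; rewrite susp_cut; case: ifP => [_|]; last first.
    by case: s s0 => [|x [|y s]] //= _ _; rewrite P0_letter linear0.
  by rewrite /P0 susp_map // -susp_linear; apply: eq_susp => t ts; rewrite nuE.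
(* In suspended form [g] moves from the blocks [g f q] into the arguments of [h p], which becomes
   [psi] on words of at least two letters; on single letters both truncated maps vanish. *)
have chi'E n s : (0 < n)%N -> size s = n ->
    psiphi mu gf h q n s = Ainf_comp psi phi n s.
  move=> n0 sn; rewrite /psiphi /Ainf_comp; congr (_ + _).
    by rewrite -phiE.
  apply: (@signZ_inj _ _ 'C(n, 2)); move: sn; rewrite -[s]twistK size_twist.
  set t := twist s => tn; rewrite -tn.
  have t0 : t != [::] by rewrite -size_eq0 tn -lt0n.
  have psi_lin k : (1 < k)%N -> multilinear k (psi k) by move=> /ltnW/psi_gr[].
  rewrite !Bsum_susp //; last by move=> k _; apply: lin_gr (hp'_gr k).
  rewrite (@eq_blocks _ _ _ _ (g \o susp phi)) => [|a a0 _]; last first.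
    by rewrite gfqE /= susp_phi.
  rewrite blocks_comp; apply: eq_blocksr => // w w0 /=.
  rewrite cut_p ?susp_cut; last by case: (w) w0.
  case: ifP => [w1|]; last first.
    by case: w w0 => [|x [|y w]] //= _ _; rewrite P0_letter linear0.
  rewrite susp_psiE // PE; last by case: (w) w0.
  by case: w w1 {w0} => [|x [|y w]] //= _; rewrite add0r.
have chi'_gr n : (0 < n)%N -> graded_map n (n%:Z - 1) (Ainf_comp psi phi n).
  by move=> n0; apply: eq_graded_map (chi_gr n n0) => s; apply: chi'E.
have susp_chi' s : s != [::] -> susp (Ainf_comp psi phi) s = chi s.
  by move=> s0; apply: eq_susp => t ts; rewrite chi'E ?lt0n ?size_eq0.
have nu_diff s : s != [::] -> susp_diff nu s
    = unary1 (cc_diff W) s + susp_nu f g P0 s.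
  by move=> s0; rewrite /susp_diff susp_nuE.
have nu_coder (M : zmodType) (G : seq W -> M) s : susp_coder nu G s
    = coder (unary1 (@odd_inv R W)) (fun s => unary1 (cc_diff W) s + susp_nu f g P0 s)
        (unary1 id) G s.
  by apply: eq_coderE => a a0 _; apply: nu_diff.
split.
  apply: (relation_susp mu_gr) => //; first by move=> n _; apply: lin_gr (p_gr n).
  move=> s s0; have [e _ _ _] := transferV s s0; apply: etrans e; congr (_ + _).
  rewrite (@eq_blocks _ _ _ _ (g \o f \o Q)) => [|a _ _]; last exact: gfqE.
  apply: eq_blocksr => // w w0; rewrite susp_cut; case: ifP => // w1.
  by case: w w0 w1 => [|x [|y w]] //= _ _; rewrite P0_letter.
split.
- apply/(Ainf_susp (fun n _ => nu_gr n)) => s s0.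
  rewrite nu_coder (eq_coderr _ _ _ s0 nu_diff).
  by have [e _] := transferW s s0.
- apply: (morphism_susp mu_gr nu_lin phi_gr) => s s0.
  rewrite (eq_blocksr _ s0 nu_diff) /susp_coder (eq_coderr _ _ _ s0 susp_phi).
  have [_ e _ _] := transferV s s0; apply: etrans e.
  by apply: eq_blocks => a a0 _; apply: susp_phi.
- apply: (morphism_susp (fun n _ => nu_gr n) mu_lin psi_gr) => s s0.
  rewrite nu_coder (eq_coderr _ _ _ s0 susp_psiE).
  have [_ e] := transferW s s0; apply: etrans e.
  by apply: eq_blocks => a a0 _; apply: susp_psiE.
apply: (homotopy_susp mu_gr chi'_gr H_gr) => [s s0|].
  have [_ _ _ e] := transferV s s0; rewrite susp_chi' //; apply: etrans e; congr (_ + _).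
    by apply: eq_coderr.
  by apply: eq_coder => a a0 _; split; rewrite //= ?susp_chi' ?susp_H.
apply: (morphism_susp mu_gr mu_lin chi'_gr) => s s0.
rewrite /susp_coder (eq_coderr _ _ _ s0 susp_chi').
have [_ _ e _] := transferV s s0; apply: etrans e.
by apply: eq_blocks => a a0 _; apply: susp_chi'.
Qed.
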